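(* Let $H$ be a separable Hilbert space, let $X$ be an $H$-valued random variable satisfying assumptions (A1) and (A2) given in the context, and let $m$ be its geometric median. Let $\alpha\in(1/2,1)$, $c_\gamma>0$, $\gamma_n=c_\gamma n^{-\alpha}$, and let $(Z_n)_{n\ge 1}$ be the stochastic gradient sequence $$Z_{n+1}=Z_n+\gamma_n\frac{X_{n+1}-Z_n}{\|X_{n+1}-Z_n\|},\qquad n\ge 1,$$ where $X_1,X_2,\dots$ are independent copies of $X$ and $Z_1$ is bounded. Then for all $p\ge 1$ there is a positive constant $K_p$ such that for all $n\ge 1$, $$\mathbb{E}\left[\|Z_n-m\|^{2p}\right]\le \frac{K_p}{n^{p\alpha}}.$$ As a corollary, for all $p\ge 1$ and all $n\ge 1$, $$\mathbb{E}\left[\|Z_n-m\|^{p}\right]\le \frac{\sqrt{K_p}}{n^{p\alpha/2}}.$$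
   Context: $H$ is a separable Hilbert space (possibly infinite dimensional) with inner product $\langle\cdot,\cdot\rangle$ and norm $\|\cdot\|$. The geometric median of $X$ is $m:=\arg\min_{h\in H}\mathbb{E}[\|X-h\|-\|X\|]$. No moment assumption is made on $X$. Assumptions: (A1) For all $h\in H$ there is $h'\in H$ such that $\langle h,h'\rangle=0$ and $\mathrm{Var}(\langle X,h'\rangle)>0$. (This ensures that $m$ is uniquely defined.) (A2) There is a positive constant $C$ such that for all $h\in H$, $\mathbb{E}[1/\|X-h\|]\le C$ and $\mathbb{E}[1/\|X-h\|^2]\le C$. $X_1,X_2,\dots$ are independent random variables with the same law as $X$. The initialization $Z_1$ is bounded (for instance $Z_1=X_1\mathbf 1_{\{\|X_1\|\le M\}}$ with $M$ a constant) or deterministic; it is measurable with respect to $\sigma(X_1)$. The event $X_{n+1}=Z_n$ has probability zero under (A2). *)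

(* Defs.v *)
From HB Require Import structures.
From mathcomp Require Import all_boot all_order all_algebra finmap.
From mathcomp Require Import all_classical all_reals all_analysis.

Set Implicit Arguments.
Unset Strict Implicit.
Unset Printing Implicit Defensive.

Import Order.TTheory GRing.Theory Num.Theory.
Import numFieldNormedType.Exports.

Local Open Scope classical_set_scope.
Local Open Scope ring_scope.

Definition separable (T : topologicalType) : Prop :=
  exists2 D : set T, countable D & dense D.

(* The norm of H is the one induced by the inner product; a Hilbert space is
   a completeNormedModType with an inner product satisfying this. *)
Definition induces_norm (R : realType) (H : normedModType R)
    (dot : {dot H for idfun}) : Prop :=
  forall x : H, `|x| = Num.sqrt (dot x x).

Notation borel H := (g_sigma_algebraType (@open H)).

Definition mutually_independent (d d' : measure_display)
    (Omega : measurableType d) (T : measurableType d') (R : realType)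
    (P : probability Omega R) (I : choiceType) (X : I -> {RV P >-> T}) : Prop :=
  forall (J : {fset I}) (B : I -> set T),
    (forall i, i \in J -> measurable (B i)) ->
    P (\bigcap_(i in [set` J]) (X i @^-1` B i)) =
      (\prod_(i <- J) P (X i @^-1` B i))%E.

Definition same_law (d d' : measure_display)
    (Omega : measurableType d) (T : measurableType d') (R : realType)
    (P : probability Omega R) (X Y : {RV P >-> T}) : Prop :=
  forall B : set T, measurable B -> distribution P X B = distribution P Y B.

(* Z is measurable with respect to sigma(X). *)
Definition sigma_measurable (d d1 d2 : measure_display)
    (Omega : measurableType d) (T1 : measurableType d1)
    (T2 : measurableType d2) (X : Omega -> T1) (Z : Omega -> T2) : Prop :=
  measurable_fun setT (Z : g_sigma_algebra_preimageType X -> T2).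

Section GeometricMedian.
Context (d : measure_display) (Omega : measurableType d) (R : realType).
Context (P : probability Omega R) (H : completeNormedModType R).
Implicit Types (X : {RV P >-> borel H}) (m : H).

Definition geometric_median X m : Prop :=
  forall h : H,
    ('E_P[fun w => (`|X w - m| - `|X w|)%R]
       <= 'E_P[fun w => (`|X w - h| - `|X w|)%R])%E.

(* No moment of X is assumed: the library variance of a real random variable
   that is not square-integrable is +oo, also when its mean is undefined. *)
Definition assumption_A1 (dot : {dot H for idfun}) X : Prop :=
  forall h : H, exists h' : H,
    dot h h' = 0 /\ (0 < 'V_P[fun w => dot (X w) h'])%E.

(* The inverses are taken in the extended reals, where 0^-1 = +oo, so that an
   atom of X at h makes these expectations infinite. *)
Definition assumption_A2 X : Prop :=
  exists C : R, 0 < C /\ forall h : H,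
    (\int[P]_w (`|X w - h|%R%:E)^-1 <= C%:E)%E /\
    (\int[P]_w ((`|X w - h| ^+ 2)%R%:E)^-1 <= C%:E)%E.

Definition step_size (c alpha : R) (n : nat) : R := c * n%:R `^ (- alpha).

(* When X_{n+1} = Z_n, an event of probability zero under (A2), the update
   term is 0 because 0^-1 = 0 in R. *)
Definition sgd_sequence (gamma : nat -> R)
    (X : nat -> {RV P >-> borel H}) (Z : nat -> Omega -> H) : Prop :=
  forall n : nat, (0 < n)%N -> forall w : Omega,
    Z n.+1 w = Z n w +
      gamma n *: (`|X n.+1 w - Z n w|^-1 *: (X n.+1 w - Z n w)).

End GeometricMedian.

(* Main.v *)
Require Import Defs.
From mathcomp Require Import all_boot all_order all_algebra finmap.
From mathcomp Require Import all_classical all_reals all_analysis.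
From mathcomp Require Import measurable_realfun ring lra.

(** Write [V = |Z - m| ^ 2] for the squared error and [g] for the step size. The
    error is measured by [(V + g) ^ p * exp (sqrt (1 + V))], the exponential of
    a concave function of [V], so one step of the algorithm is controlled by
    [exp x <= 1 + x + 2 x ^ 2] with [x] affine in the increment of [V].

    The expected increment satisfies [E <X - z, z - m> / |X - z| <= - c V / sqrt (1 + V)]
    uniformly in [z]: it is quadratic in [|z - m|] near [m] but only linear far
    away, because the gradient is bounded. Near [m] the power and far away the
    exponential turn this into a contraction by the factor [1 - c g], up to an
    additive error of order [g ^ (p + 1)]; hence [E |Z_n - m| ^ 2p] is of order
    [g_n ^ p], directly and for every real [p >= 1].

    The uniform constant [c] comes from (A1): the support of [X - m] contains two
    linearly independent points, and no line through the origin is close to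
    both, so in every direction the convexity of the norm yields a gain on an
    event whose probability is bounded below. *)

Set Implicit Arguments.
Unset Strict Implicit.
Unset Printing Implicit Defensive.

Import Order.TTheory GRing.Theory Num.Theory.
Import numFieldNormedType.Exports.

Local Open Scope classical_set_scope.
Local Open Scope ring_scope.

(** * The Lyapunov function *)

(** From [expR (- x) >= 1 - x] one gets [expR x * (1 - x) <= 1], and the right-hand side times
    [1 - x] exceeds 1 by [x ^+ 2 * (1 - 2 * x)]. *)
Lemma expR_le_quad (R : realType) (x : R) :
  x <= 1 / 2 -> expR x <= 1 + x + 2 * x ^+ 2.
Proof.
move=> hx; have h1 : 0 < 1 - x by lra.
have := expR_ge1Dx (- x); rewrite expRN => h.
have hp := expR_gt0 x.
have {h} : expR x * (1 - x) <= 1.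
  by rewrite -[leRHS](mulfV (lt0r_neq0 hp)) ler_pM2l.
move=> h; rewrite -(ler_pM2r h1); apply: (le_trans h).
have : 0 <= x ^+ 2 * (1 - 2 * x) by apply: mulr_ge0; [exact: sqr_ge0|lra].
lra.
Qed.

Lemma ln_tangent (R : realType) (x y : R) :
  0 < x -> 0 < y -> ln y <= ln x + x^-1 * (y - x).
Proof.
move=> x0 y0; rewrite -lerBlDl -ln_div ?posrE//.
have -> : x^-1 * (y - x) = y / x - 1 by field; lra.
have := @le_ln1Dx R (y / x - 1).
rewrite [1 + _]addrC subrK; apply.
by rewrite ltrBDl subrr divr_gt0.
Qed.

Lemma sqrt_tangent (R : realType) (x y : R) : 0 < x -> 0 <= y ->
  Num.sqrt y <= Num.sqrt x + (2 * Num.sqrt x)^-1 * (y - x).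
Proof.
move=> x0 y0; have r0 : 0 < Num.sqrt x by rewrite sqrtr_gt0.
have -> : y - x = Num.sqrt y ^+ 2 - Num.sqrt x ^+ 2 by rewrite !sqr_sqrtr// ltW.
move: (Num.sqrt x) (Num.sqrt y) r0 => a b a0.
have ia : a^-1 * a = 1 by rewrite mulVf// gt_eqF.
have -> : (2 * a)^-1 = a^-1 / 2 by field; lra.
have : 0 <= a^-1 * (b - a) ^+ 2 by rewrite mulr_ge0 ?sqr_ge0// invr_ge0 ltW.
have -> : a^-1 * (b - a) ^+ 2 =
    a^-1 * (b ^+ 2 - a ^+ 2) - 2 * b * (a^-1 * a) + 2 * a * (a^-1 * a) by ring.
rewrite ia; lra.
Qed.

Definition lyap (R : realType) (p g V : R) :=
  expR (p * ln (V + g) + Num.sqrt (1 + V)).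

(** The derivative in [V] of the exponent of [lyap p g V]. *)
Definition lyap_slope (R : realType) (p g V : R) :=
  p / (V + g) + (2 * Num.sqrt (1 + V))^-1.

(** The exponent of [lyap] is concave in [V], hence below its tangent at [V]. The slope is
    nonnegative, so the upper bound [D] may replace the increment [V' - V]. *)
Lemma lyap_concave (R : realType) (p g V V' D : R) : 0 <= p -> 0 < g ->
  0 <= V -> 0 <= V' -> V' <= V + D ->
  lyap p g V' <= lyap p g V * expR (lyap_slope p g V * D).
Proof.
move=> p0 g0 V0 V'0 hV'; rewrite /lyap -expRD ler_expR.
have lnle : ln (V' + g) <= ln (V + g) + (V + g)^-1 * D.
  apply: (le_trans (@ln_tangent R (V + g) (V' + g) _ _)); [lra|lra|].
  by rewrite lerD2l ler_wpM2l ?invr_ge0; lra.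
have sqle : Num.sqrt (1 + V') <= Num.sqrt (1 + V) + (2 * Num.sqrt (1 + V))^-1 * D.
  apply: (le_trans (@sqrt_tangent R (1 + V) (1 + V') _ _)); [lra|lra|].
  by rewrite lerD2l ler_wpM2l ?invr_ge0 ?mulr_ge0 ?sqrtr_ge0//; lra.
have := ler_wpM2l p0 lnle.
rewrite /lyap_slope; lra.
Qed.

Lemma lyap_slope_ge0 (R : realType) (p g V : R) : 0 <= p -> 0 < g -> 0 <= V ->
  0 <= lyap_slope p g V.
Proof.
move=> p0 g0 V0; rewrite addr_ge0 ?invr_ge0 ?divr_ge0 ?mulr_ge0 ?sqrtr_ge0//.
lra.
Qed.

(** [b] is the part of [lyap_slope] due to the exponential factor. Here and below [s] stands for the
    drift, whose absolute value is at most the distance to [m]. *)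
Lemma invM2sqrt_bounds (R : realType) (V s : R) : 0 <= V -> s ^+ 2 <= V ->
  let b := (2 * Num.sqrt (1 + V))^-1 in
  [/\ 0 <= b, b <= 1 / 2, b ^+ 2 * V <= 1 / 4 & b * s <= 1 / 2].
Proof.
move=> V0 sV b.
have q1 : 1 <= Num.sqrt (1 + V) by rewrite -[leLHS]sqrtr1 ler_wsqrtr//; lra.
have qE : Num.sqrt (1 + V) ^+ 2 = 1 + V by rewrite sqr_sqrtr//; lra.
have bq : b * (2 * Num.sqrt (1 + V)) = 1 by rewrite mulVf//; lra.
have b0 : 0 <= b by rewrite invr_ge0; lra.
move: (Num.sqrt (1 + V)) b q1 qE bq b0 => q b q1 qE bq b0.
have bbE : b ^+ 2 * q ^+ 2 = 1 / 4.
  have -> : b ^+ 2 * q ^+ 2 = (b * (2 * q)) ^+ 2 / 4 by field.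
  by rewrite bq; field.
split=> //.
- nra.
- rewrite -bbE ler_wpM2l ?sqr_ge0//; lra.
- have sq : s <= q by nra.
  have : b * s <= b * q by rewrite ler_wpM2l.
  lra.
Qed.

(** Makes [expR_le_quad] applicable. With [q = Num.sqrt g], AM-GM gives [2 * q * s <= V + g], so the
    slope [p / (V + g)] contributes at most [2 * p * q] and the other one at most [3 / 2 * q]; the
    hypothesis on [g] says that [4 * (p + 1) * q <= 1]. *)
Lemma lyap_slope_small (R : realType) (p g V s : R) : 0 <= p -> 0 < g -> g <= 1 ->
  0 <= V -> s ^+ 2 <= V -> (4 * (p + 1)) ^+ 2 * g <= 1 ->
  lyap_slope p g V * (2 * g * s + g ^+ 2) <= 1 / 2.
Proof.
move=> p0 g0 g1 V0 sV gsmall; rewrite /lyap_slope.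
have [] := @invM2sqrt_bounds R V s V0 sV.
move: ((2 * Num.sqrt (1 + V))^-1) => b b0 b1 _ bs.
have aE : (V + g)^-1 * (V + g) = 1 by rewrite mulVf//; lra.
have a0 : 0 <= (V + g)^-1 by rewrite invr_ge0; lra.
move: ((V + g)^-1) aE a0 => a aE a0.
have q0 : 0 <= Num.sqrt g by rewrite sqrtr_ge0.
have qE : g = Num.sqrt g ^+ 2 by rewrite sqr_sqrtr// ltW.
move: (Num.sqrt g) q0 qE => q q0 qE.
have q1 : q <= 1 by nra.
have pq : 4 * (p + 1) * q <= 1.
  have h0 : 0 <= 4 * (p + 1) * q by apply: mulr_ge0 => //; lra.
  rewrite -(ler_pXn2r (_ : 0 < 2)%N) ?nnegrE//; rewrite expr1n exprMn -qE//.
have sq : 2 * q * s <= V + g by have := sqr_ge0 (q - s); rewrite qE; lra.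
have asq : a * (2 * q * s) <= 1 by rewrite -[leRHS]aE ler_wpM2l.
have ag : a * g <= 1 by rewrite -[leRHS]aE ler_wpM2l//; lra.
have gq : g <= q by nra.
have h1 : p * (a * (2 * g * s)) <= p * q.
  by rewrite ler_wpM2l//; have := ler_wpM2l q0 asq; rewrite [in 2 * g]qE; lra.
have h2 : p * (a * g ^+ 2) <= p * q.
  by rewrite ler_wpM2l//; have := ler_wpM2l (ltW g0) ag; lra.
have h3 : b * (2 * g * s) <= q by have := ler_wpM2l (ltW g0) bs; lra.
have h4 : b * g ^+ 2 <= q / 2.
  have -> : b * g ^+ 2 = (b * g) * g by ring.
  have : b * g <= 1 / 2 by nra.
  nra.
nra.
Qed.

(** The squared increment is at most [g ^+ 2 * (8 * V + 2 * g ^+ 2)]. Since [V / (V + g) <= 1], its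
    factor [V] cancels one of the two factors [(V + g)^-1] of the squared slope. *)
Lemma lyap_second_order (R : realType) (p g V s : R) : 0 <= p -> 0 < g -> g <= 1 ->
  0 <= V -> s ^+ 2 <= V ->
  lyap_slope p g V * g ^+ 2 +
    2 * (lyap_slope p g V * (2 * g * s + g ^+ 2)) ^+ 2 <=
  (32 * p ^+ 2 + p + 11) * g ^+ 2 * ((V + g)^-1 + 1).
Proof.
move=> p0 g0 g1 V0 sV; rewrite /lyap_slope.
have [] := @invM2sqrt_bounds R V s V0 sV.
move: ((2 * Num.sqrt (1 + V))^-1) => b b0 b1 bV _.
have aE : (V + g)^-1 * (V + g) = 1 by rewrite mulVf//; lra.
have a0 : 0 <= (V + g)^-1 by rewrite invr_ge0; lra.
move: ((V + g)^-1) aE a0 => a aE a0.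
have ag : a * g <= 1 by rewrite -[leRHS]aE ler_wpM2l//; lra.
have aV : a * V <= 1 by rewrite -[leRHS]aE ler_wpM2l//; lra.
have ag0 : 0 <= a * g by rewrite mulr_ge0// ltW.
pose F := p * a + b.
have F2 : F ^+ 2 <= 2 * (p * a) ^+ 2 + 2 * b ^+ 2.
  by have := sqr_ge0 (p * a - b); rewrite /F; lra.
have FV : F ^+ 2 * V <= 2 * p ^+ 2 * a + 1 / 2.
  have := ler_wpM2r V0 F2.
  have := ler_wpM2l (mulr_ge0 (sqr_ge0 p) a0) aV.
  lra.
have Fg : F ^+ 2 * g ^+ 2 <= 2 * p ^+ 2 + 1 / 2.
  have := ler_wpM2r (sqr_ge0 g) F2.
  have h1 : (a * g) ^+ 2 <= 1 by rewrite expr_le1.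
  have := ler_wpM2l (sqr_ge0 p) h1.
  have h2 : b ^+ 2 <= 1 / 4 by nra.
  have h3 : b ^+ 2 * g ^+ 2 <= 1 / 4 by have := sqr_ge0 b; nra.
  lra.
have D2 : (2 * g * s + g ^+ 2) ^+ 2 <= g ^+ 2 * (8 * V + 2 * g ^+ 2).
  have -> : (2 * g * s + g ^+ 2) ^+ 2 = g ^+ 2 * (2 * s + g) ^+ 2 by ring.
  by rewrite ler_wpM2l ?sqr_ge0//; have := sqr_ge0 (2 * s - g); lra.
have FD : F ^+ 2 * (2 * g * s + g ^+ 2) ^+ 2 <=
    g ^+ 2 * (16 * p ^+ 2 * a + 4 * p ^+ 2 + 5).
  apply: (le_trans (ler_wpM2l (sqr_ge0 F) D2)).
  have -> : F ^+ 2 * (g ^+ 2 * (8 * V + 2 * g ^+ 2)) =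
    g ^+ 2 * (8 * (F ^+ 2 * V) + 2 * (F ^+ 2 * g ^+ 2)) by ring.
  by rewrite ler_wpM2l ?sqr_ge0//; lra.
rewrite -/F exprMn.
have -> : (32 * p ^+ 2 + p + 11) * g ^+ 2 * (a + 1) =
  g ^+ 2 * ((32 * p ^+ 2 + p + 11) * (a + 1)) by ring.
have h : g ^+ 2 * (F + 2 * (16 * p ^+ 2 * a + 4 * p ^+ 2 + 5)) <=
    g ^+ 2 * ((32 * p ^+ 2 + p + 11) * (a + 1)).
  by rewrite ler_wpM2l ?sqr_ge0// /F; have := sqr_ge0 p; lra.
apply: le_trans h; lra.
Qed.

(** The bound is affine in [s], so averaging it over the new sample requires only the mean of the
    drift. *)
Lemma lyap_step (R : realType) (p g V V' s : R) : 0 <= p -> 0 < g -> g <= 1 ->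
  0 <= V -> 0 <= V' -> s ^+ 2 <= V -> (4 * (p + 1)) ^+ 2 * g <= 1 ->
  V' <= V + (2 * g * s + g ^+ 2) ->
  lyap p g V' <= lyap p g V *
    (1 + (32 * p ^+ 2 + p + 11) * g ^+ 2 * ((V + g)^-1 + 1)
       + 2 * g * lyap_slope p g V * s).
Proof.
move=> p0 g0 g1 V0 V'0 sV gsmall hV'.
apply: (le_trans (@lyap_concave R p g V V' _ p0 g0 V0 V'0 hV')).
rewrite ler_wpM2l ?expR_ge0//.
apply: (le_trans (expR_le_quad _)); first exact: lyap_slope_small.
have := @lyap_second_order R p g V s p0 g0 g1 V0 sV.
lra.
Qed.

(** With [i = (Num.sqrt (1 + V))^-1], the power contributes [p * i] up to the error
    [p * (g / (V + g))], and the exponential contributes [(1 - i ^+ 2) / 2]. For [0 <= i <= 1 <= p]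
    these add up to at least [1 / 2]. *)
Lemma lyap_drift (R : realType) (p g V : R) : 1 <= p -> 0 < g -> 0 <= V ->
  1 / 2 - p * (g / (V + g)) <= lyap_slope p g V * (V / Num.sqrt (1 + V)).
Proof.
move=> p1 g0 V0; rewrite /lyap_slope.
have q1 : 1 <= Num.sqrt (1 + V) by rewrite -[leLHS]sqrtr1 ler_wsqrtr//; lra.
have qE : Num.sqrt (1 + V) ^+ 2 = 1 + V by rewrite sqr_sqrtr//; lra.
move: (Num.sqrt (1 + V)) q1 qE => q q1 qE.
have -> : (2 * q)^-1 = q^-1 / 2 by field; lra.
have iq : q^-1 * q = 1 by rewrite mulVf//; lra.
have i0 : 0 <= q^-1 by rewrite invr_ge0; lra.
move: (q^-1) iq i0 => i iq i0.
have i1 : i <= 1 by nra.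
have aE : (V + g)^-1 * (V + g) = 1 by rewrite mulVf//; lra.
have a0 : 0 <= (V + g)^-1 by rewrite invr_ge0; lra.
move: ((V + g)^-1) aE a0 => a aE a0.
have aV : a * V = 1 - g * a by lra.
have iV : i ^+ 2 * V = 1 - i ^+ 2.
  have -> : i ^+ 2 * V = (i * q) ^+ 2 - i ^+ 2 + i ^+ 2 * (1 + V - q ^+ 2) by ring.
  by rewrite iq qE; ring.
have -> : (p * a + i / 2) * (V * i) = p * i * (a * V) + (i ^+ 2 * V) / 2 by ring.
rewrite aV iV.
have h1 : 0 <= p * (g * a * (1 - i)).
  by rewrite !mulr_ge0//; lra.
have h2 : i ^+ 2 <= i by nra.
have h3 : i <= p * i by nra.
lra.
Qed.

(* Splitting according to whether [V + g] exceeds [L g] with [L] large, the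
   terms of order [g ^+ 2 / (V + g)] are either absorbed by [c * g] or only
   matter where the Lyapunov function is itself of order [g `^ p]. *)
Lemma lyap_contraction (R : realType) (p c : R) : 1 <= p -> 0 < c ->
  exists g0 C : R, [/\ 0 < g0, 0 < C & forall g V : R,
    0 < g -> g <= g0 -> 0 <= V ->
    [/\ g <= 1, (4 * (p + 1)) ^+ 2 * g <= 1 &
    lyap p g V *
    (1 + (32 * p ^+ 2 + p + 11) * g ^+ 2 * ((V + g)^-1 + 1)
       - 2 * g * lyap_slope p g V * (c * (V / Num.sqrt (1 + V)))) <=
    (1 - c / 2 * g) * lyap p g V + C * (g * g `^ p)]].
Proof.
move=> p1 c0.
pose C1 := 32 * p ^+ 2 + p + 11.
have C10 : 0 < C1 by have := sqr_ge0 p; rewrite /C1; lra.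
(* [C2] gathers the coefficients of [g ^+ 2 / (V + g)]: [C1] from the second-order term, and
   [2 * c * p] from the error in [lyap_drift] multiplied by [2 * c * g]. *)
pose C2 := C1 + 2 * c * p.
have C20 : 0 < C2 by rewrite addr_gt0// !mulr_gt0//; lra.
(* With this [L], [C2 * (g / (V + g)) <= c / 4] as soon as [L * g <= V + g]. Otherwise [V <= L], and
   [C] is read off from [lyap p g V] at [V + g = L * g], with [L] in place of [V] in the
   exponential. *)
pose L := 4 * C2 / c.
have L0 : 0 < L by rewrite divr_gt0// mulr_gt0.
pose C := C2 * (L `^ p * expR (Num.sqrt (1 + L))).
have C0 : 0 < C by rewrite !mulr_gt0 ?powR_gt0 ?expR_gt0.
have m0 : 0 < (4 * (p + 1)) ^+ 2 by rewrite exprn_gt0//; lra.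
(* The last bound gives [C1 * g ^+ 2 <= c / 4 * g]. The drift yields the factor [1 - c * g], and the
   two errors cost [c / 4 * g] each. *)
pose g0 := Num.min 1 (Num.min ((4 * (p + 1)) ^+ 2)^-1 (c / (4 * C1))).
exists g0, C; split => //.
  by rewrite !lt_min ltr01 invr_gt0 m0/= divr_gt0// mulr_gt0.
move=> g V gp; rewrite !le_min => /and3P[g1 g2 g3] V0; split => //.
  by rewrite -[leRHS](mulfV (lt0r_neq0 m0)) ler_wpM2l// ltW.
rewrite -/C1.
have := @lyap_drift R p g V p1 gp V0.
set Dr := lyap_slope _ _ _ * _ => hDr.
have hg3 : C1 * g ^+ 2 <= c / 4 * g.
  rewrite expr2 mulrA ler_wpM2r//; first exact: ltW.
  by move: g3; rewrite ler_pdivlMr ?mulr_gt0//; lra.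
have lyp : 0 < lyap p g V by exact: expR_gt0.
have cgDr : c * g * (1 / 2 - p * (g / (V + g))) <= c * g * Dr.
  by rewrite ler_wpM2l// mulr_ge0// ltW.
have key : lyap p g V * (C2 * (g ^+ 2 / (V + g))) <= lyap p g V * (c / 4 * g) + C * (g * g `^ p).
  have [hL|hL] := leP (L * g) (V + g).
    have : C2 * (g ^+ 2 / (V + g)) <= c / 4 * g.
      have hVg : 0 < V + g by lra.
      have -> : C2 * (g ^+ 2 / (V + g)) = g * (C2 * (g / (V + g))) by field; lra.
      rewrite [leRHS]mulrC ler_wpM2l//; first exact: ltW.
      rewrite mulrA ler_pdivrMr//.
      have := ler_wpM2l (ltW (_ : 0 < c / 4)) hL; rewrite divr_gt0// => /(_ isT).
      have -> : c / 4 * (L * g) = C2 * g by rewrite /L; field; lra.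
      by [].
    move=> /(ler_wpM2l (ltW lyp)).
    have : 0 <= C * (g * g `^ p) by rewrite !mulr_ge0 ?powR_ge0// ltW.
    lra.
  have hVg : 0 < V + g by lra.
  have VL : V <= L by have := ler_piMr (ltW L0) g1; lra.
  have lle : lyap p g V <= L `^ p * g `^ p * expR (Num.sqrt (1 + L)).
    rewrite -powRM ?(ltW L0) ?(ltW gp)//.
    have -> : (L * g) `^ p = expR (p * ln (L * g)) by rewrite /powR gt_eqF// mulr_gt0.
    have h1 : ln (V + g) <= ln (L * g).
      by rewrite ler_ln ?posrE; [exact: ltW|by []|exact: mulr_gt0].
    have h2 : Num.sqrt (1 + V) <= Num.sqrt (1 + L) by rewrite ler_wsqrtr// lerD2l.
    rewrite -expRD ler_expR lerD//.
    by apply: ler_wpM2l => //; lra.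
  have gle : C2 * (g ^+ 2 / (V + g)) <= C2 * g.
    by rewrite ler_pM2l// ler_pdivrMr// expr2 ler_wpM2l//; [exact: ltW|lra].
  have gle0 : 0 <= C2 * (g ^+ 2 / (V + g)).
    by apply: mulr_ge0; [exact: ltW|apply: divr_ge0; [exact: sqr_ge0|exact: ltW]].
  have h := ler_pM (ltW lyp) gle0 lle gle.
  apply: (@le_trans _ _ (C * (g * g `^ p))).
    by apply: (le_trans h); rewrite /C; lra.
  by rewrite lerDr mulr_ge0 ?mulr_ge0 ?(ltW lyp) ?(ltW gp)//; lra.
have hE : (C2 * (g ^+ 2 / (V + g))) = C1 * g ^+ 2 * (V + g)^-1 + 2 * c * p * g * (g / (V + g)).
  by rewrite /C2; field; lra.
rewrite hE in key.
have := ler_wpM2l (ltW lyp) cgDr.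
have := ler_wpM2l (ltW lyp) hg3.
have -> : 2 * g * lyap_slope p g V * (c * (V / Num.sqrt (1 + V))) = 2 * (c * g * Dr).
  by rewrite /Dr; ring.
move: key; lra.
Qed.

Lemma lyap_homo (R : realType) (p g g' V V' : R) : 0 <= p -> 0 < g -> g <= g' ->
  0 <= V -> V <= V' -> lyap p g V <= lyap p g' V'.
Proof.
move=> p0 g0 gg V0 VV; rewrite /lyap ler_expR lerD//.
  by rewrite ler_wpM2l// ler_ln ?posrE; lra.
by rewrite ler_wsqrtr// lerD2l.
Qed.

Lemma powR_le_lyap (R : realType) (p g x : R) : 0 < p -> 0 < g -> 0 <= x ->
  x `^ (2 * p) <= lyap p g (x ^+ 2).
Proof.
move=> p0 g0 x0; rewrite powRrM powR_mulrn//.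
have h : (x ^+ 2) `^ p <= (x ^+ 2 + g) `^ p.
  by apply: ge0_ler_powR; rewrite ?nnegrE ?addr_ge0 ?sqr_ge0 ?lerDl ?(ltW p0) ?(ltW g0).
apply: (le_trans h); rewrite /lyap expRD /powR gt_eqF ?ltr_wpDl ?sqr_ge0//.
rewrite ler_peMr ?expR_ge0//.
have := expR_ge1Dx (Num.sqrt (1 + x ^+ 2)); have := sqrtr_ge0 (1 + x ^+ 2); lra.
Qed.

Lemma measurable_lyap (R : realType) d (T : measurableType d) (p g : R) (f : T -> R) :
  measurable_fun setT f -> measurable_fun setT (fun w => lyap p g (f w)).
Proof.
move=> mf; apply: (measurableT_comp (@measurable_expR R)).
apply: measurable_funD.
  apply: measurable_funM => //.
  by apply: (measurableT_comp (@measurable_ln R)); exact: measurable_funD.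
apply: (measurableT_comp (continuous_measurable_fun (@sqrt_continuous R))).
exact: measurable_funD.
Qed.

(** * Geometry of the norm *)

Section inner_product.
Variables (R : realType) (H : normedModType R) (dot : {dot H for idfun}).
Hypothesis dot_norm : induces_norm dot.
Implicit Types x y z v u : H.

Lemma dotC x y : dot x y = dot y x.
Proof. by rewrite hermC expr0 mul1r. Qed.

Lemma dot_ge0 x : 0 <= dot x x.
Proof.
have [->|x0] := eqVneq x 0; first by rewrite linear0l.
by rewrite ltW// neq0_dnorm_gt0.
Qed.

Lemma dotxx x : dot x x = `|x| ^+ 2.
Proof. by rewrite dot_norm sqr_sqrtr// dot_ge0. Qed.

Lemma dotZl (a : R) x y : dot (a *: x) y = a * dot x y.
Proof. by rewrite linearZl_LR. Qed.

Lemma dotZr (a : R) x y : dot x (a *: y) = a * dot x y.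
Proof. by rewrite dotC dotZl dotC. Qed.

Lemma dotBr x y z : dot x (y - z) = dot x y - dot x z.
Proof. exact: linearBr. Qed.

Lemma normB_sqr x y : `|x - y| ^+ 2 = `|x| ^+ 2 - 2 * dot x y + `|y| ^+ 2.
Proof.
rewrite -!dotxx linearBl !linearBr/= (dotC y x); ring.
Qed.

Lemma normD_sqr x y : `|x + y| ^+ 2 = `|x| ^+ 2 + 2 * dot x y + `|y| ^+ 2.
Proof.
rewrite -!dotxx linearDl !linearDr/= (dotC y x); ring.
Qed.

Lemma cauchy_schwarz x y : dot x y <= `|x| * `|y|.
Proof.
have : `|x + y| ^+ 2 <= (`|x| + `|y|) ^+ 2.
  by rewrite ler_pXn2r ?nnegrE ?addr_ge0 ?normr_ge0// ler_normD.
by rewrite normD_sqr; lra.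
Qed.

Lemma cauchy_schwarz_normr x y : `|dot x y| <= `|x| * `|y|.
Proof.
rewrite ler_norml cauchy_schwarz andbT lerNl.
have <- : dot (- x) y = - dot x y by rewrite linearNl.
by rewrite -(normrN x) cauchy_schwarz.
Qed.

Lemma normr_dot_unit_le x v : `|(`|x|^-1 * dot x v)| <= `|v|.
Proof.
have [->|x0] := eqVneq x 0; first by rewrite normr0 invr0 mul0r normr0.
rewrite normrM ger0_norm ?invr_ge0// ler_pdivrMl ?normr_gt0//.
exact: cauchy_schwarz_normr.
Qed.

(* The difference of the two sides is [|x| - <x - v, x> / |x - v|], the defect
   in the Cauchy-Schwarz inequality for the pair [(x, x - v)]. *)
Lemma subgradient_norm x v :
  `|x - v| - `|x| <= - (`|x - v|^-1 * dot (x - v) v).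
Proof.
have [xv|xv] := eqVneq (x - v) 0.
  by rewrite xv normr0 invr0 mul0r sub0r lerN2.
have n0 : 0 < `|x - v| by rewrite normr_gt0.
rewrite -(ler_pM2l n0) mulrN mulVKf ?gt_eqF// mulrBr.
have -> : dot (x - v) v = dot (x - v) x - dot (x - v) (x - v).
  by rewrite -linearBr subKr.
rewrite dotxx opprB -expr2 lerB//.
exact: cauchy_schwarz.
Qed.

(** A quantitative Cauchy-Schwarz inequality. With [a = |x|], [n = |x - v|] and [e = <x - v, x>],
    the product [(a * n - e) * (a * n + e)] is the Gram determinant of [x - v] and [x], which equals
    that of [x] and [v]; the second factor is at most [2 * M * n], and [n <= M + 1]. *)
Lemma subgradient_norm_gain (M delta : R) x v : 0 < M -> 0 <= delta ->
  `|x| <= M -> `|v| <= 1 ->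
  delta * `|v| ^+ 2 <= `|x| ^+ 2 * `|v| ^+ 2 - dot x v ^+ 2 ->
  `|x - v| - `|x| + delta / (2 * M * (M + 1) ^+ 2) * `|v| ^+ 2
    <= - (`|x - v|^-1 * dot (x - v) v).
Proof.
move=> M0 d0 xM v1 gram.
(* If [v = x], the Gram determinant vanishes, so the hypothesis forces the gain to be zero. *)
have [xv|xv] := eqVneq (x - v) 0.
  have := subgradient_norm x v; apply: le_trans.
  move: gram; have -> : v = x by apply/esym/eqP; rewrite -subr_eq0 xv.
  rewrite dotxx => gram.
  have h : delta * `|x| ^+ 2 = 0.
    by apply/eqP; rewrite eq_le mulr_ge0 ?sqr_ge0// andbT; lra.
  by rewrite mulrAC h mul0r addr0.
have n0 : 0 < `|x - v| by rewrite normr_gt0.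
rewrite -(ler_pM2l n0) mulrN mulVKf ?gt_eqF//.
have -> : dot (x - v) v = dot (x - v) x - `|x - v| ^+ 2.
  by rewrite -dotxx -linearBr subKr.
have yM : `|x - v| <= M + 1 by apply: (le_trans (ler_normB _ _)); exact: lerD.
have dE : dot (x - v) x = `|x| ^+ 2 - dot x v by rewrite linearBl/= dotxx (dotC v).
have yE := normB_sqr x v.
have cs := cauchy_schwarz (x - v) x.
have cs' := cauchy_schwarz_normr (x - v) x.
have gramE : (`|x| * `|x - v|) ^+ 2 - dot (x - v) x ^+ 2 =
    `|x| ^+ 2 * `|v| ^+ 2 - dot x v ^+ 2.
  by rewrite exprMn yE dE; ring.
rewrite -gramE in gram.
have x0 := normr_ge0 x.
set c := delta / _.
have cE : c * (2 * M * (M + 1) ^+ 2) = delta.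
  by rewrite /c mulfVK// !mulf_neq0// ?expf_neq0//; lra.
have c0 : 0 <= c by rewrite /c divr_ge0// !mulr_ge0 ?sqr_ge0//; lra.
move: cs'; rewrite ler_norml => /andP[cs' _].
move: c c0 cE gram cs cs' yM x0 xM.
move: (dot (x - v) x) (`|x - v|) n0 (`|x|) (`|v|) (normr_ge0 v) v1 => e n n0 a w w0 w1.
move=> c c0 cE gram cs cs' nM a0 aM; rewrite -cE in gram.
rewrite leNgt; apply/negP => hlt.
have h1 : a * n - e < c * w ^+ 2 * n by lra.
have h2 : 0 < M * n by rewrite mulr_gt0.
have h3 : (a * n - e) * (a * n + e) <= (a * n - e) * (2 * (M * n)).
  rewrite ler_wpM2l//; first lra.
  have := ler_wpM2r (ltW n0) aM; lra.
have h4 : (a * n - e) * (2 * (M * n)) < c * w ^+ 2 * n * (2 * (M * n)).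
  by rewrite ltr_pM2r// mulr_gt0.
have h5 : c * w ^+ 2 * (2 * M) * n ^+ 2 <= c * w ^+ 2 * (2 * M) * (M + 1) ^+ 2.
  rewrite ler_wpM2l ?mulr_ge0 ?sqr_ge0//; first lra.
  by rewrite ler_pXn2r ?nnegrE//; lra.
lra.
Qed.

(** Monotonicity of the subgradient of the convex function [y |-> |x - y|] along the ray through
    [u]: with [a = x - u] and [b = x - t *: u], one has [<a / |a| - b / |b|, a - b> >= 0], where
    [a - b = (t - 1) *: u]. *)
Lemma unit_vector_monotone x u (t : R) : 1 <= t ->
  `|x - t *: u|^-1 * dot (x - t *: u) u <= `|x - u|^-1 * dot (x - u) u.
Proof.
move=> t1; have [->|tn1] := eqVneq t 1; first by rewrite scale1r.
have t10 : 0 < t - 1 by rewrite subr_gt0 lt_neqAle eq_sym tn1.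
rewrite -(ler_pM2l t10).
have dE y : (t - 1) * (`|y|^-1 * dot y u) = `|y|^-1 * dot y ((x - u) - (x - t *: u)).
  have -> : (x - u) - (x - t *: u) = (t - 1) *: u.
    by rewrite scalerBl scale1r opprB addrC addrA subrK.
  by rewrite dotZr mulrCA.
rewrite !dE; move: (x - u) (x - t *: u) => a b {dE}.
have nE (y : H) : `|y|^-1 * dot y y = `|y|.
  have [->|y0] := eqVneq y 0; first by rewrite normr0 invr0 mul0r.
  by rewrite dotxx expr2 mulKf// normr_eq0.
rewrite !dotBr !mulrBr !nE.
have h (y z : H) : `|y|^-1 * dot y z <= `|z|.
  exact: le_trans (ler_norm _) (normr_dot_unit_le _ _).
have := h a b; have := h b a; lra.
Qed.

(** If [l1 *: v] were close to [y1] and [l2 *: v] close to [y2], eliminating [v] would place [y2]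
    close to [(l2 / l1) *: y1], although [y2] has positive distance [eta] to the line through
    [y1]. *)
Lemma line_avoids_independent_pair (y1 y2 : H) : (forall l : R, y2 != l *: y1) ->
  y1 != 0 ->
  exists b : R, 0 < b /\ forall v : H,
    (forall l : R, b <= `|y1 - l *: v|) \/ (forall l : R, b <= `|y2 - l *: v|).
Proof.
move=> y2n y1n0.
have n1 : 0 < `|y1| by rewrite normr_gt0.
(* The coefficient of the orthogonal projection of [y2] on the line through [y1]. *)
pose k := dot y1 y2 / `|y1| ^+ 2.
pose eta := `|y2 - k *: y1|.
have eta0 : 0 < eta by rewrite normr_gt0 subr_eq0.
have etaP l : eta <= `|y2 - l *: y1|.
  rewrite -(ler_pXn2r (_ : 0 < 2)%N) ?nnegrE//.
  have -> : y2 - l *: y1 = (y2 - k *: y1) + (k - l) *: y1.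
    by rewrite scalerBl addrA subrK.
  rewrite [leRHS]normD_sqr -/eta dotZr dotC dotBr dotZr dotxx.
  have -> : dot y1 y2 - k * `|y1| ^+ 2 = 0.
    by rewrite /k mulfVK ?subrr// expf_neq0// normr_eq0.
  - by rewrite !mulr0 addr0 lerDl sqr_ge0.
  - exact: ltW.
pose q := 1 + 2 * (`|y2| + 1) / `|y1|.
have q0 : 0 < q by rewrite addr_gt0// divr_gt0// mulr_gt0//; have := normr_ge0 y2; lra.
(* The first bound keeps [l1 *: v] away from 0, the second bounds [l2 *: v]. Together they give
   [1 + |l2 / l1| <= q], so by the third the elimination error is at most [eta / 2]. *)
pose b := Num.min (`|y1| / 2) (Num.min 1 (eta / (2 * q))).
exists b; split; first by rewrite !lt_min ltr01/= !divr_gt0// mulr_gt0.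
have [b1 b2 b3] : [/\ b <= `|y1| / 2, b <= 1 & b <= eta / (2 * q)].
  by split; rewrite /b !ge_min lexx ?orbT.
move=> v; apply: contrapT => /not_orP[/existsNP[l1 /negP] + /existsNP[l2 /negP]].
rewrite -!ltNge => h1 h2.
have l1v : `|y1| / 2 <= `|l1 *: v|.
  have := lerB_dist y1 (y1 - l1 *: v); rewrite subKr; lra.
have l10 : l1 != 0.
  by apply/eqP => l10; move: l1v; rewrite l10 scale0r normr0; lra.
have l2v : `|l2 *: v| <= `|y2| + 1.
  have := ler_normB y2 (y2 - l2 *: v); rewrite subKr; lra.
have : `|y2 - (l2 / l1) *: y1| <= b + `|l2 / l1| * b.
  have -> : y2 - (l2 / l1) *: y1 = (y2 - l2 *: v) - (l2 / l1) *: (y1 - l1 *: v).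
    by rewrite scalerBr scalerA mulfVK// opprB addrA subrK.
  apply: (le_trans (ler_normB _ _)); rewrite normrZ lerD ?(ltW h2)//.
  by rewrite ler_wpM2l// ltW.
have r : `|l2 / l1| <= 2 * (`|y2| + 1) / `|y1|.
  have v0 : 0 < `|v|.
    by rewrite normr_gt0; apply/eqP => v0; move: l1v; rewrite v0 scaler0 normr0; lra.
  have l1v0 : 0 < `|l1| by rewrite normr_gt0.
  rewrite normrM normfV ler_pdivrMr// mulrAC ler_pdivlMr//.
  rewrite -(ler_pM2r v0); move: l1v l2v; rewrite !normrZ.
  have := normr_ge0 y2; nra.
have : b + `|l2 / l1| * b <= q * b.
  have b0 : 0 <= b by rewrite (le_trans _ (ltW h1)).
  by rewrite /q mulrDl mul1r lerD2l ler_wpM2r.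
have : q * b <= eta / 2.
  have := ler_wpM2l (ltW q0) b3.
  by have -> : q * (eta / (2 * q)) = eta / 2 by field; lra.
have := etaP (l2 / l1); lra.
Qed.

(** For [v != 0] the Gram determinant is [|v| ^+ 2] times the squared distance from [x] to its
    projection on the line through [v]. *)
Lemma gram_ge_of_dist (b : R) x v : 0 <= b -> (forall l : R, b <= `|x - l *: v|) ->
  b ^+ 2 * `|v| ^+ 2 <= `|x| ^+ 2 * `|v| ^+ 2 - dot x v ^+ 2.
Proof.
move=> b0 h; have [->|v0] := eqVneq v 0.
  by rewrite normr0 linear0r expr0n/= !mulr0 subrr.
have n0 : 0 < `|v| ^+ 2 by rewrite exprn_gt0// normr_gt0.
have : b ^+ 2 <= `|x - (dot x v / `|v| ^+ 2) *: v| ^+ 2.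
  by rewrite ler_pXn2r ?nnegrE.
move=> /(ler_wpM2r (ltW n0)); rewrite normB_sqr dotZr normrZ exprMn real_normK ?num_real//.
have -> : (`|x| ^+ 2 - 2 * (dot x v / `|v| ^+ 2 * dot x v) +
   (dot x v / `|v| ^+ 2) ^+ 2 * `|v| ^+ 2) * `|v| ^+ 2 =
   `|x| ^+ 2 * `|v| ^+ 2 - dot x v ^+ 2 by field; rewrite normr_eq0.
by [].
Qed.

End inner_product.

(** * Borel measurability in separable Hilbert spaces *)

Lemma invS_lt (R : realType) (e : R) : 0 < e -> exists k : nat, k.+1%:R^-1 < e.
Proof. by move=> /ltr_add_invr[k]; rewrite add0r; exists k. Qed.

Lemma separable_seq (R : realType) (H : normedModType R) : separable H ->
  exists q : nat -> H, forall x (e : R), 0 < e -> exists n, `|x - q n| < e.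
Proof.
move=> [D /countable_injP[f injf] dD].
(* The inverse of the injection [f] on [D], with default value 0 outside its range. *)
exists (fun n => xget 0 [set x | D x /\ f x = n]) => x e e0.
have [y [/= xy Dy]] : ball x e `&` D !=set0.
  by apply: dD; [exists x; exact: ballxx|exact: ball_open].
exists (f y); case: xgetP => [z _ [Dz fz]|/(_ y)[]//].
have -> : z = y by apply: injf; rewrite ?inE.
by move: xy; rewrite -ball_normE.
Qed.

Section borel_separable.
Variables (R : realType) (H : completeNormedModType R).
Hypothesis Hsep : separable H.

Lemma open_measurable_borel (U : set H) : open U -> measurable (U : set (borel H)).
Proof. by move=> oU; apply: sub_sigma_algebra. Qed.

Lemma measurable_normB_cst (q : H) :
  measurable_fun setT (fun x : borel H => `|(x : H) - q|).
Proof.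
apply: (measurability _ (RGenOInfty.measurableE R)) => /= _ [_ [a ->] <-].
rewrite setTI; apply: open_measurable_borel.
have cf : continuous (fun x : H => `|x - q|).
  by move=> x; apply: cvg_norm; apply: cvgB; [exact: cvg_id|exact: cvg_cst].
by move/continuousP : cf; apply; exact: interval_open.
Qed.

(** The measurability is for the product of the two Borel sigma-algebras. By density of [q],
    [|x - y| < a] holds exactly when [|x - q n| + |y - q n| < a] for some [n], which is a countable
    union. *)
Lemma measurable_normB_pair :
  measurable_fun setT (fun z : borel H * borel H => `|(z.1 : H) - (z.2 : H)|).
Proof.
have [q qP] := separable_seq Hsep.
apply: (measurability _ (RGenInftyO.measurableE R)) => /= _ [_ [a ->] <-].
rewrite setTI.
rewrite [X in measurable X](_ : _ = \bigcup_n
  [set z : borel H * borel H | `|(z.1 : H) - q n| + `|(z.2 : H) - q n| < a]).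
  apply: bigcup_measurable => n _.
  have m1 : measurable_fun setT (fun z : borel H * borel H =>
      `|(z.1 : H) - q n| + `|(z.2 : H) - q n|).
    apply: measurable_funD.
      exact: (measurableT_comp (measurable_normB_cst (q n)) measurable_fst).
    exact: (measurableT_comp (measurable_normB_cst (q n)) measurable_snd).
  have := m1 measurableT `]-oo, a[%classic (measurable_itv _).
  by rewrite setTI; congr measurable; apply/seteqP; split => z /=; rewrite in_itv.
apply/seteqP; split => [z|z [n _]] /=; rewrite in_itv/=.
  move=> za; have e0 : 0 < (a - `|(z.1 : H) - (z.2 : H)|) / 2 by rewrite divr_gt0// subr_gt0.
  have [n hn] := qP z.1 _ e0; exists n => //=.
  have : `|(z.2 : H) - q n| <= `|(z.1 : H) - (z.2 : H)| + `|(z.1 : H) - q n|.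
    rewrite -[in leLHS](subrK (z.1 : H) (z.2 : H)) -addrA.
    by rewrite (le_trans (ler_normD _ _))// distrC.
  lra.
apply: le_lt_trans; rewrite (distrC (z.2 : H)).
by rewrite (le_trans _ (ler_normD _ _))// addrA subrK.
Qed.

(** Every open set is a countable union of balls with centres [q n] and radii [k.+1%:R^-1]. *)
Lemma measurable_fun_borel d (T : measurableType d) (f : T -> H) :
  (forall q : H, measurable_fun setT (fun w => `|f w - q|)) ->
  measurable_fun setT (f : T -> borel H).
Proof.
move=> mf; have [q qP] := separable_seq Hsep.
apply: (@measurability _ _ T (borel H) setT f (@open H)) => //= _ [U oU <-].
rewrite setTI [X in measurable X](_ : _ = \bigcup_n \bigcup_(k in
   [set k | ball (q n) k.+1%:R^-1 `<=` U]) [set w | `|f w - q n| < k.+1%:R^-1]).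
  apply: bigcup_measurable => n _; apply: bigcup_measurable => k _.
  have := mf (q n) measurableT `]-oo, k.+1%:R^-1[%classic (measurable_itv _).
  by rewrite setTI; congr measurable; apply/seteqP; split => z /=; rewrite in_itv.
apply/seteqP; split => [w /= Ufw|w [n _ [k /= kU wk]]]; last first.
  by apply: kU; rewrite -ball_normE/= distrC.
have /nbhs_ballP[e /= e0 eU] : nbhs (f w) U by apply: open_nbhs_nbhs.
have [k ke] := invS_lt (divr_gt0 e0 (ltr0Sn _ 1)).
have [n hn] := qP (f w) k.+1%:R^-1 ltac:(by rewrite invr_gt0).
exists n => //; exists k => //= y; rewrite -ball_normE/= => qy.
apply: eU; rewrite -ball_normE/=.
have -> : f w - y = (f w - q n) + (q n - y) by rewrite addrA subrK.
apply: (le_lt_trans (ler_normD _ _)); rewrite (splitr e).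
by apply: ltrD; [exact: lt_trans hn ke|exact: lt_trans qy ke].
Qed.

Lemma measurable_normB d (T : measurableType d) (X Z : T -> borel H) :
  measurable_fun setT X -> measurable_fun setT Z ->
  measurable_fun setT (fun w => `|(X w : H) - (Z w : H)|).
Proof.
by move=> mX mZ; apply: (measurableT_comp measurable_normB_pair (measurable_fun_pair mX mZ)).
Qed.

Lemma measurable_invr : measurable_fun setT (fun x : R => `|x|^-1).
Proof.
rewrite (_ : (fun x : R => _) = fun x => `|x| `^ (-1)).
  by apply: (measurableT_comp (measurable_powR (-1))) => //; exact: normr_measurable.
by apply/funext => x; rewrite powR_inv1.
Qed.

Variable dot : {dot H for idfun}.
Hypothesis dot_norm : induces_norm dot.

(** Polarization expresses the inner product through the distances between [X], [Z] and [q]. *)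
Lemma measurable_dotB d (T : measurableType d) (X Z : T -> borel H) (q : H) :
  measurable_fun setT X -> measurable_fun setT Z ->
  measurable_fun setT (fun w => dot ((X w : H) - Z w) ((Z w : H) - q)).
Proof.
move=> mX mZ.
rewrite (_ : (fun w => _) = fun w => 2^-1 * (`|(X w : H) - q| ^+ 2 -
    `|(X w : H) - Z w| ^+ 2 - `|(Z w : H) - q| ^+ 2)).
  have m1 := measurableT_comp (measurable_normB_cst q) mX.
  have m2 := measurableT_comp (measurable_normB_cst q) mZ.
  have m3 := measurable_normB mX mZ.
  by apply: measurable_funM => //; do ![apply: measurable_funB|exact: measurable_funX].
apply/funext => w.
have -> : (X w : H) - q = ((X w : H) - Z w) + ((Z w : H) - q) by rewrite addrA subrK.
by rewrite (normD_sqr dot_norm); field.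
Qed.

Definition sgd_step (g : R) (z x : H) : H := z + g *: (`|x - z|^-1 *: (x - z)).

(** The last squared factor is 1, or 0 when [x = z]; keeping it makes the identity valid in both
    cases. *)
Lemma sgd_step_normB_sqr (g : R) (z x q : H) :
  `|sgd_step g z x - q| ^+ 2 = `|z - q| ^+ 2 +
    2 * g * (`|x - z|^-1 * dot (x - z) (z - q)) + g ^+ 2 * (`|x - z|^-1 * `|x - z|) ^+ 2.
Proof.
rewrite /sgd_step addrAC (normD_sqr dot_norm) !(dotZr dot) (dotC dot (z - q)) normrZ exprMn.
rewrite real_normK ?num_real// normrZ normfV normr_id; ring.
Qed.

Lemma measurable_sgd_step d (T : measurableType d) (g : R) (X Z : T -> borel H) :
  measurable_fun setT X -> measurable_fun setT Z ->
  measurable_fun setT (fun w => sgd_step g (Z w) (X w) : borel H).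
Proof.
move=> mX mZ; apply: measurable_fun_borel => q.
rewrite (_ : (fun w => _) = fun w => Num.sqrt (`|(Z w : H) - q| ^+ 2 +
   2 * g * (`|(X w : H) - Z w|^-1 * dot ((X w : H) - Z w) ((Z w : H) - q)) +
   g ^+ 2 * (`|(X w : H) - Z w|^-1 * `|(X w : H) - Z w|) ^+ 2)); last first.
  by apply/funext => w; rewrite -sgd_step_normB_sqr sqrtr_sqr normr_id.
apply: (measurableT_comp (continuous_measurable_fun (@sqrt_continuous R))).
have m3 := measurable_normB mX mZ.
have m2 := measurableT_comp (measurable_normB_cst q) mZ.
have m4 : measurable_fun setT (fun w => `|(X w : H) - Z w|^-1).
  rewrite (_ : (fun w => _) = fun w => `|(`|(X w : H) - Z w|)|^-1).
    exact: (measurableT_comp measurable_invr m3).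
  by apply/funext => w; rewrite normr_id.
have m5 := measurable_dotB q mX mZ.
apply: measurable_funD; last first.
  by apply: measurable_funM => //; apply: measurable_funX; exact: measurable_funM.
apply: measurable_funD; first exact: measurable_funX.
by apply: measurable_funM => //; exact: measurable_funM.
Qed.

End borel_separable.

(** * Drift towards the median *)

Lemma bounded_integrable (R : realType) d (T : measurableType d)
    (P : probability T R) (f : T -> R) (M : R) :
  measurable_fun setT f -> (forall w, `|f w| <= M) ->
  P.-integrable setT (EFin \o f).
Proof.
move=> mf fM; apply: measurable_bounded_integrable => //.
  by rewrite -ge0_fin_numE// fin_num_measure.
exists M; split; first exact: num_real.
by move=> x Mx w _ /=; exact: le_trans (fM w) (ltW Mx).
Qed.

Section median_drift.
Context (R : realType) (H : completeNormedModType R) (dot : {dot H for idfun}).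
Context d (Omega : measurableType d) (P : probability Omega R).
Variables (X : {RV P >-> borel H}) (m : H).
Hypothesis dot_norm : induces_norm dot.
Hypothesis Hsep : separable H.

(** The topological support of the law of [X - m]. *)
Definition in_support (y : H) : Prop := forall e : R, 0 < e ->
  (0 < P [set w | (`|(X w : H) - m - y| < e)%R])%E.

Lemma measurable_near_point (y : H) (e : R) :
  measurable [set w | `|(X w : H) - m - y| < e].
Proof.
have := measurableT_comp (measurable_normB_cst (m + y)) (measurable_funPT X).
move=> /(_ measurableT `]-oo, e[%classic (measurable_itv _)).
rewrite setTI; congr measurable; apply/seteqP; split => w /=;
by rewrite in_itv/= opprD addrA.
Qed.

(** A point outside the support has a null neighbourhood, hence lies in a null ball with centre
    [q n] and radius [k.+1%:R^-1]; there are countably many such balls. *)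
Lemma ae_in_support : {ae P, forall w, in_support ((X w : H) - m)}.
Proof.
have [q qP] := separable_seq Hsep.
pose B n k := [set w | `|(X w : H) - m - q n| < k.+1%:R^-1 :> R].
pose F n k := if P (B n k) == 0%E then B n k else set0.
have F0 n k : P.-negligible (F n k).
  rewrite /F; case: ifPn => [/eqP h|_]; last exact: negligible_set0.
  by apply/negligibleP => //; exact: measurable_near_point.
apply: (@negligibleS _ _ _ _ (\bigcup_n \bigcup_k F n k)); last first.
  by apply: negligible_bigcup => n; exact: negligible_bigcup.
move=> w /= /existsNP[e /not_implyP[e0 /negP]]; rewrite -leNgt measure_le0 => /eqP PB.
have [k ke] := invS_lt (divr_gt0 e0 (ltr0Sn _ 1)).
have [n hn] := qP ((X w : H) - m) k.+1%:R^-1 ltac:(by rewrite invr_gt0).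
exists n => //; exists k => //; rewrite /F ifT//.
rewrite -measure_le0 -PB; apply: le_measure; rewrite ?inE; try exact: measurable_near_point.
move=> w' /=; rewrite /B/= => h.
have -> : (X w' : H) - m - ((X w : H) - m) =
    ((X w' : H) - m - q n) - ((X w : H) - m - q n).
  by move: (_ - m) (_ - m) => a b; rewrite opprB addrA subrK.
apply: (le_lt_trans (ler_normB _ _)); rewrite (splitr e).
by apply: ltrD; [exact: lt_trans h ke|exact: lt_trans hn ke].
Qed.

Lemma measurable_dot_cst (h : H) : measurable_fun setT (fun w => dot (X w) h).
Proof.
rewrite (_ : (fun w => _) = fun w => 2^-1 * (`|(X w : H) - 0| ^+ 2 + `|h| ^+ 2 -
    `|(X w : H) - h| ^+ 2)).
  have m1 := measurableT_comp (measurable_normB_cst (0 : H)) (measurable_funPT X).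
  have m2 := measurableT_comp (measurable_normB_cst h) (measurable_funPT X).
  apply: measurable_funM => //; apply: measurable_funB; last exact: measurable_funX.
  by apply: measurable_funD => //; exact: measurable_funX.
by apply/funext => w; rewrite subr0 (normB_sqr dot_norm); field.
Qed.

Hypothesis A1 : assumption_A1 dot X.

(** For the [h] that (A1) associates with [y], [<X, h>] would almost surely equal the constant
    [<m, h>] and have zero variance. The case [y = 0] excludes that [X] is almost surely [m]. *)
Lemma not_ae_on_line (y : H) :
  ~ {ae P, forall w, exists l : R, (X w : H) - m = l *: y}.
Proof.
move=> line; have [h [yh]] := A1 y.
suff -> : ('V_P[fun w => dot (X w) h] = 0)%E by rewrite ltxx.
have mf := measurable_dot_cst h.
pose c := dot m h.
have fc : {ae P, forall w, dot (X w) h = c}.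
  apply: filterS line => w [l lE].
  have -> : (X w : H) = m + l *: y by rewrite -lE addrC subrK.
  by rewrite linearDl/= dotZl yh mulr0 addr0.
have Ef : ('E_P[fun w => dot (X w) h] = c%:E)%E.
  rewrite -(expectation_cst P c) unlock; apply: ae_eq_integral => //.
  - exact/measurable_EFinP.
  - exact/measurable_EFinP.
  - by apply: filterS fc => w /= -> _.
rewrite /variance unlock Ef/=.
transitivity ('E_P[cst (0 : R)%R])%E; last exact: expectation_cst.
rewrite unlock.
apply: ae_eq_integral => //.
- by apply/measurable_EFinP; apply: measurable_funM; apply: measurable_funB.
- exact/measurable_EFinP.
- by apply: filterS fc => w /= fE _; rewrite /GRing.mul/= fE subrr mulr0.
Qed.

(** Only the event depends on [v]: it says that [X - m] is within [b / 2] of whichever of the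
    support points [y1], [y2] lies at distance at least [b] from the line through [v]. Its points
    then stay at distance [b / 2] from that line. *)
Lemma uniform_gram_lower_bound : exists M delta pi : R, [/\ 0 < M, 0 < delta, 0 < pi &
  forall v : H, exists A : set Omega, [/\ measurable A, (pi%:E <= P A)%E &
   forall w, A w -> `|(X w : H) - m| <= M /\
     delta * `|v| ^+ 2 <= `|(X w : H) - m| ^+ 2 * `|v| ^+ 2 - dot ((X w : H) - m) v ^+ 2]].
Proof.
have [y1 s1 y10] : exists2 y1, in_support y1 & y1 != 0.
  apply: contrapT => h; apply: (@not_ae_on_line 0).
  apply: filterS ae_in_support => w sw; exists 0; rewrite scaler0.
  by apply/eqP; apply: contrapT => /negP n0; apply: h; exists ((X w : H) - m).
have [y2 s2 y2n] : exists2 y2, in_support y2 & forall l : R, y2 != l *: y1.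
  apply: contrapT => h; apply: (@not_ae_on_line y1).
  apply: filterS ae_in_support => w sw; apply: contrapT => n0.
  apply: h; exists ((X w : H) - m) => // l; apply/negP => /eqP e; apply: n0; exists l; exact: e.
have [b [b0 hb]] := line_avoids_independent_pair dot_norm y2n y10.
have b20 : 0 < b / 2 by rewrite divr_gt0.
pose A y := [set w | `|(X w : H) - m - y| < b / 2].
have finA y : P (A y) = (fine (P (A y)))%:E.
  by rewrite fineK// fin_num_measure//; exact: measurable_near_point.
have p1 := s1 _ b20; have p2 := s2 _ b20.
rewrite -/(A y1) finA lte_fin in p1; rewrite -/(A y2) finA lte_fin in p2.
exists (`|y1| + `|y2| + b), ((b / 2) ^+ 2), (Num.min (fine (P (A y1))) (fine (P (A y2)))).
have n1 := normr_ge0 y1; have n2 := normr_ge0 y2.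
split; [lra|by rewrite exprn_gt0|by rewrite lt_min p1|].
have key y v : `|y| <= `|y1| + `|y2| -> (forall l : R, b <= `|y - l *: v|) ->
  forall w, A y w -> `|(X w : H) - m| <= `|y1| + `|y2| + b /\
     (b / 2) ^+ 2 * `|v| ^+ 2 <= `|(X w : H) - m| ^+ 2 * `|v| ^+ 2 - dot ((X w : H) - m) v ^+ 2.
  move=> yM yv w; rewrite /A/=; set x := (X w : H) - m => xy; split.
    have := ler_normD y (x - y); rewrite addrC subrK; lra.
  apply: (gram_ge_of_dist dot_norm); first exact: ltW.
  move=> l; have := yv l.
  have -> : y - l *: v = (x - l *: v) - (x - y).
    by rewrite opprB [RHS]addrC addrA subrK.
  have := ler_normB (x - l *: v) (x - y); lra.
move=> v; have [h|h] := hb v.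
  exists (A y1); split; [exact: measurable_near_point| |].
    by rewrite [leRHS]finA lee_fin ge_min lexx.
  by apply: key => //; lra.
exists (A y2); split; [exact: measurable_near_point| |].
  by rewrite [leRHS]finA lee_fin ge_min lexx orbT.
by apply: key => //; lra.
Qed.

Hypothesis m_median : geometric_median X m.

(** By [sgd_step_normB_sqr], [2 * g * drift z x] is the first-order change of the squared error. *)
Definition drift (z x : H) : R := `|x - z|^-1 * dot (x - z) (z - m).

Lemma drift_le (z x : H) : `|drift z x| <= `|z - m|.
Proof. exact: (normr_dot_unit_le dot_norm). Qed.

Lemma measurable_drift d' (T : measurableType d') (Z Y : T -> borel H) :
  measurable_fun setT Z -> measurable_fun setT Y ->
  measurable_fun setT (fun w => drift (Z w) (Y w)).
Proof.
move=> mZ mY; apply: measurable_funM; last exact: measurable_dotB.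
rewrite (_ : (fun w => _) = fun w => `|(`|(Y w : H) - Z w|)|^-1).
  exact: (measurableT_comp (@measurable_invr R) (measurable_normB Hsep mY mZ)).
by apply/funext => w; rewrite normr_id.
Qed.

Lemma integrable_drift (z : H) : P.-integrable setT (fun w => (drift z (X w))%:E).
Proof.
apply: (@bounded_integrable _ _ _ _ _ `|z - m|).
  by apply: measurable_drift => //; exact: measurable_funPT.
by move=> w; exact: drift_le.
Qed.

(** Compares the median criterion at [m + v] and at [m]. Since [|X - h| - |X|] is bounded by [|h|],
    both expectations are finite without any moment and may be subtracted. *)
Lemma integral_norm_increment_ge0 (v : H) :
  (0 <= \int[P]_w (`|(X w : H) - m - v| - `|(X w : H) - m|)%:E)%E.
Proof.
have i (h : H) : P.-integrable setT (EFin \o (fun w => `|(X w : H) - h| - `|X w : H|)).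
  apply: (@bounded_integrable _ _ _ _ _ `|h|).
    have mX := measurable_funPT X.
    apply: measurable_funB; first exact: (measurableT_comp (measurable_normB_cst h) mX).
    rewrite (_ : (fun w => _) = fun w => `|(X w : H) - 0|).
      exact: (measurableT_comp (measurable_normB_cst (0 : H)) mX).
    by apply/funext => w; rewrite subr0.
  move=> w; apply: le_trans (ler_dist_dist _ _) _.
  by rewrite addrC addKr normrN.
have := m_median (m + v); rewrite unlock.
rewrite -sube_ge0; last by rewrite (integrable_fin_num _ (i m)).
rewrite -integralB_EFin//.
move=> /le_trans; apply; rewrite le_eqVlt; apply/orP; left; apply/eqP.
by apply: eq_integral => w _; rewrite -EFinB opprD addrA; congr (_%:E); ring.
Qed.

(** Integrates [subgradient_norm_gain] on the event [A] and [subgradient_norm] off it; the increment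
    of the norm has nonnegative mean because [m] is the median. *)
Lemma integral_drift_small : exists2 c : R, 0 < c & forall v : H, `|v| <= 1 ->
  (\int[P]_w (drift (m + v) (X w))%:E <= (- (c * `|v| ^+ 2))%:E)%E.
Proof.
have [M [delta [pi [M0 d0 p0 hA]]]] := uniform_gram_lower_bound.
pose k := delta / (2 * M * (M + 1) ^+ 2).
have k0 : 0 < k by rewrite divr_gt0// !mulr_gt0//; lra.
exists (k * pi); first exact: mulr_gt0.
move=> v v1; have [A [mA piA hAw]] := hA v.
have mX := measurable_funPT X.
pose f w := `|(X w : H) - m - v| - `|(X w : H) - m|.
have if_ : P.-integrable setT (EFin \o f).
  apply: (@bounded_integrable _ _ _ _ _ `|v|).
    apply: measurable_funB; last exact: (measurableT_comp (measurable_normB_cst m) mX).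
    rewrite (_ : (fun w => _) = fun w => `|(X w : H) - (m + v)|).
      exact: (measurableT_comp (measurable_normB_cst (m + v)) mX).
    by apply/funext => w; rewrite opprD addrA.
  move=> w; apply: le_trans (ler_dist_dist _ _) _.
  by rewrite addrC addKr normrN.
have iA : P.-integrable setT (fun w => (\1_A w : R)%:E) by exact: integrable_indic.
pose K := k * `|v| ^+ 2.
have K0 : 0 <= K by rewrite mulr_ge0 ?sqr_ge0// ltW.
have iKA : P.-integrable setT (EFin \o (fun w => - K * (\1_A w : R))).
  rewrite (_ : _ \o _ = fun w => ((- K)%:E * (\1_A w : R)%:E)%E).
    exact: integrableZl.
  by apply/funext => w; rewrite /= EFinM.
have hle w : drift (m + v) (X w) <= - K * \1_A w - f w.
  have E : (X w : H) - (m + v) = (X w : H) - m - v by rewrite opprD addrA.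
  rewrite /drift E (_ : m + v - m = v); last by rewrite addrC addKr.
  rewrite mulNr -opprD lerNr indicE addrC; have [Aw|nAw] := boolP (w \in A).
    rewrite mulr1; have [] := hAw w (set_mem Aw).
    move=> xM gr; exact: (subgradient_norm_gain dot_norm M0 (ltW d0) xM v1 gr).
  by rewrite mulr0 addr0; exact: (subgradient_norm dot_norm).
apply: (@le_trans _ _ (\int[P]_w ((- K * \1_A w)%:E - (f w)%:E))%E).
  apply: le_integral => //; first exact: integrable_drift.
    exact: (integrableB measurableT iKA if_).
  by move=> w _; rewrite -EFinB lee_fin.
rewrite (integralB_EFin _ iKA if_)//.
have -> : (\int[P]_w (- K * \1_A w)%:E = (- K)%:E * P A)%E.
  under eq_integral do rewrite EFinM.
  by rewrite integralZl// integral_indic// setIT.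
apply: (@le_trans _ _ ((- K)%:E * P A)%E).
  rewrite -[leRHS]adde0 leeD2l//; rewrite leeNl oppe0.
  exact: integral_norm_increment_ge0.
have -> : - (k * pi * `|v| ^+ 2) = - K * pi by rewrite /K; ring.
rewrite EFinM EFinN !mulNe leeN2 lee_wpmul2l//.
Qed.

Lemma integral_drift : exists2 c : R, 0 < c & forall z : H,
  (\int[P]_w (drift z (X w))%:E <=
    (- (c * (`|z - m| ^+ 2 / Num.sqrt (1 + `|z - m| ^+ 2))))%:E)%E.
Proof.
have [c c0 hc] := integral_drift_small.
exists c => // z; pose v := z - m; rewrite -/v.
have q1 : 1 <= Num.sqrt (1 + `|v| ^+ 2).
  by rewrite -[leLHS]sqrtr1 ler_wsqrtr//; have := sqr_ge0 `|v|; lra.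
have [v1|v1] := leP `|v| 1.
  have := hc v v1; rewrite {1}/v addrC subrK => /le_trans; apply.
  rewrite lee_fin lerN2 ler_pM2l// ler_pdivrMr; last lra.
  by rewrite ler_peMr// sqr_ge0.
(* Beyond the unit ball, monotonicity along the ray reduces to the bound at the unit vector [u], so
   the pull is at least linear in [|v|]. *)
pose u := `|v|^-1 *: v.
have v0 : 0 < `|v| by lra.
have uv : v = `|v| *: u by rewrite scalerA mulfV ?scale1r// gt_eqF.
have u1 : `|u| = 1 by rewrite normrZ normfV normr_id mulVf// gt_eqF.
have := hc u; rewrite u1 lexx => /(_ isT) hu.
have hle w : drift z (X w) <= `|v| * drift (m + u) (X w).
  have Ez (y : H) : (X w : H) - (m + y) = (X w : H) - m - y by rewrite opprD addrA.
  rewrite /drift -/v (_ : z = m + v); last by rewrite addrC subrK.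
  rewrite !Ez (_ : m + u - m = u); last by rewrite addrC addKr.
  rewrite uv normrZ u1 mulr1 normr_id dotZr mulrCA ler_pM2l//.
  exact: (unit_vector_monotone dot_norm _ _ (ltW v1)).
apply: (@le_trans _ _ (`|v|%:E * \int[P]_w (drift (m + u) (X w))%:E)%E).
  rewrite -integralZl//; last exact: integrable_drift.
  apply: le_integral => //; first exact: integrable_drift.
    by apply: integrableZl => //; exact: integrable_drift.
  by move=> w _; rewrite -EFinM lee_fin.
apply: (@le_trans _ _ (`|v|%:E * (- (c * 1 ^+ 2))%:E)%E).
  by rewrite lee_wpmul2l ?lee_fin.
rewrite -EFinM lee_fin expr1n mulr1 mulrN lerN2 [leRHS]mulrC ler_pM2l//.
rewrite ler_pdivrMr; last lra.
have : `|v| <= Num.sqrt (1 + `|v| ^+ 2).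
  by rewrite -[leLHS]normr_id -sqrtr_sqr ler_wsqrtr//; lra.
by rewrite expr2 => h; rewrite ler_wpM2l.
Qed.

End median_drift.

(** * Independence *)

Section independence.
Context d (Omega : measurableType d) (R : realType) (P : probability Omega R).

(** For fixed [E] both sides are finite measures in [A] that agree on the pi-system [G], which
    contains the whole space. *)
Lemma indep_event_generated d1 (T : measurableType d1) (f : {mfun Omega >-> T})
    (G : set (set T)) (E : set Omega) :
  @measurable _ T = <<s G >> -> setI_closed G -> G setT -> measurable E ->
  (forall A, G A -> P (f @^-1` A `&` E) = (P (f @^-1` A) * P E)%E) ->
  forall A, measurable A -> P (f @^-1` A `&` E) = (P (f @^-1` A) * P E)%E.
Proof.
move=> mG GI GT mE h A mA.
have PE : P E = (fine (P E))%:E by rewrite fineK// fin_num_measure.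
have PE0 : 0 <= fine (P E) by rewrite fine_ge0.
pose r := NngNum PE0.
rewrite muleC PE.
apply: (@measure_unique _ _ _ G (fun=> setT) mG GI (fun=> GT) _
  (pushforward (mrestr P mE) f) (mscale r (pushforward P f))) => //.
- by rewrite bigcup_const.
- by move=> B GB; rewrite /= /pushforward /mrestr /mscale/= h// muleC PE.
- move=> _; rewrite /pushforward /mrestr/= -ge0_fin_numE//.
  by rewrite fin_num_measure//; exact: measurable_funPTI.
  exact: measure_ge0.
Qed.

Lemma indep_event_pair d1 d2 (S : measurableType d1) (T : measurableType d2)
    (f : {mfun Omega >-> (S * T)%type}) (E : set Omega) : measurable E ->
  (forall A B, measurable A -> measurable B ->
    P (f @^-1` (A `*` B) `&` E) = (P (f @^-1` (A `*` B)) * P E)%E) ->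
  forall C, measurable C -> P (f @^-1` C `&` E) = (P (f @^-1` C) * P E)%E.
Proof.
move=> mE h.
apply: (@indep_event_generated _ _ f
  [set A `*` B | A in measurable & B in measurable]) => //.
- exact: measurable_prod_measurableType.
- move=> _ _ [A mA [B mB <-]] [A' mA' [B' mB' <-]].
  exists (A `&` A'); first exact: measurableI.
  by exists (B `&` B'); [exact: measurableI|rewrite setXI].
- by exists setT => //; exists setT => //; rewrite setXTT.
- by move=> _ [A mA [B mB <-]]; exact: h.
Qed.

Lemma mutually_independentU1 d1 (T : measurableType d1) (I : choiceType)
    (X : I -> {RV P >-> T}) (i : I) (J : {fset I}) (A : set T) (B : I -> set T) :
  mutually_independent X -> i \notin J -> measurable A ->
  (forall j, j \in J -> measurable (B j)) ->
  P (X i @^-1` A `&` \bigcap_(j in [set` J]) (X j @^-1` B j)) =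
  (P (X i @^-1` A) * P (\bigcap_(j in [set` J]) (X j @^-1` B j)))%E.
Proof.
move=> indX iJ mA mB.
pose B' j := if j == i then A else B j.
have B'J j : j \in J -> B' j = B j.
  by move=> jJ; rewrite /B' ifN//; apply: contraNneq iJ => <-.
have B'i : B' i = A by rewrite /B' eqxx.
have EJ : \bigcap_(j in [set` J]) (X j @^-1` B j) = \bigcap_(j in [set` J]) (X j @^-1` B' j).
  by apply: eq_bigcapr => j jJ; rewrite B'J.
have mB' j : j \in (i |` J)%fset -> measurable (B' j).
  by rewrite !inE => /orP[/eqP ->|jJ]; rewrite ?B'i// B'J//; exact: mB.
have mB'J j : j \in J -> measurable (B' j) by move=> jJ; rewrite B'J//; exact: mB.
have EU : X i @^-1` A `&` \bigcap_(j in [set` J]) (X j @^-1` B' j) =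
    \bigcap_(j in [set` (i |` J)%fset]) (X j @^-1` B' j).
  by rewrite bigcap_fsetU1 B'i.
rewrite EJ EU (indX _ _ mB') big_fsetU1//=.
by rewrite (indX _ _ mB'J) B'i.
Qed.

Lemma measurable_cylinder d1 (T : measurableType d1) (I : choiceType)
    (X : I -> {RV P >-> T}) (J : {fset I}) (B : I -> set T) :
  (forall j, j \in J -> measurable (B j)) ->
  measurable (\bigcap_(j in [set` J]) (X j @^-1` B j)).
Proof.
move=> mB; rewrite bigcap_fset big_seq; apply: bigsetI_measurable => j jJ.
by apply: measurable_funPTI; exact: mB.
Qed.

(* Cylinders over arbitrary finite sets of later indices are needed because the
   induction step adds the index [n.+1] to [J]. *)
Lemma recursion_indep_future d1 d2 (S : measurableType d1) (T : measurableType d2)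
    (X : nat -> {RV P >-> T}) (Z : nat -> {RV P >-> S}) (F : nat -> S * T -> S) :
  mutually_independent X -> sigma_measurable (X 0%N) (Z 0%N) ->
  (forall n, measurable_fun setT (F n)) ->
  (forall n w, Z n.+1 w = F n (Z n w, X n.+1 w)) ->
  forall n (J : {fset nat}) (A : set S) (B : nat -> set T), measurable A ->
  (forall j, j \in J -> measurable (B j)) -> (forall j, j \in J -> (n < j)%N) ->
  P (Z n @^-1` A `&` \bigcap_(j in [set` J]) (X j @^-1` B j)) =
  (P (Z n @^-1` A) * P (\bigcap_(j in [set` J]) (X j @^-1` B j)))%E.
Proof.
move=> indX Z0 mF ZF; elim=> [|n IH] J A B mA mB nJ.
  (* The event on [Z 0] is an event on [X 0], and 0 is not in [J]. *)
  have [A' mA' ] := Z0 measurableT A mA; rewrite !setTI => <-.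
  apply: mutually_independentU1 => //.
  by apply/negP => /nJ.
pose pair w := (Z n w, X n.+1 w).
have mpair : measurable_fun setT pair by apply: measurable_fun_pair.
pose f : {mfun Omega >-> (S * T)%type} := mfun_Sub (mem_set mpair).
have mC := measurable_cylinder X mB.
have nJ1 : n.+1 \notin J by apply/negP => /nJ; rewrite ltnn.
have indE D : measurable D -> P (X n.+1 @^-1` D `&` \bigcap_(j in [set` J]) (X j @^-1` B j))
    = (P (X n.+1 @^-1` D) * P (\bigcap_(j in [set` J]) (X j @^-1` B j)))%E.
  by move=> mD; exact: mutually_independentU1.
have -> : Z n.+1 @^-1` A = f @^-1` (F n @^-1` A).
  by apply/seteqP; split => w /=; rewrite ZF.
apply: indep_event_pair => //; last by rewrite -[_ @^-1` _]setTI; exact: mF.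
move=> C D mC' mD.
have fE : f @^-1` (C `*` D) = Z n @^-1` C `&` X n.+1 @^-1` D by [].
have step (K : {fset nat}) : n.+1 \notin K -> (forall j, j \in K -> (n < j)%N) ->
    (forall j, j \in K -> measurable (B j)) ->
    P (Z n @^-1` C `&` (X n.+1 @^-1` D `&` \bigcap_(j in [set` K]) (X j @^-1` B j))) =
    (P (Z n @^-1` C) * P (X n.+1 @^-1` D `&` \bigcap_(j in [set` K]) (X j @^-1` B j)))%E.
  move=> nK nK' mBK.
  pose B' j := if j == n.+1 then D else B j.
  have B'K j : j \in K -> B' j = B j.
    by move=> jJ; rewrite /B' ifN//; apply: contraNneq nK => <-.
  have -> : X n.+1 @^-1` D `&` \bigcap_(j in [set` K]) (X j @^-1` B j) =
      \bigcap_(j in [set` (n.+1 |` K)%fset]) (X j @^-1` B' j).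
    rewrite bigcap_fsetU1 {1}/B' eqxx; congr (_ `&` _).
    by apply: eq_bigcapr => j jK; rewrite B'K.
  apply: IH => //; move=> j; rewrite !inE => /orP[/eqP ->//|jK].
  - by rewrite /B' eqxx.
  - by rewrite B'K//; exact: mBK.
  - exact: nK'.
rewrite fE -setIA step//; last by move=> j /nJ; exact: ltnW.
have := step fset0; rewrite set_fset0 bigcap_set0 setIT => ->//.
by rewrite indE// muleA.
Qed.

(** The joint law of [(Y, X)] is the product of the laws, so Tonelli's theorem applies; this stands
    in for conditioning on [Y]. *)
Lemma ge0_integral_indep d1 d2 (S : measurableType d1) (T : measurableType d2)
    (Y : {RV P >-> S}) (X X' : {RV P >-> T}) (h : S * T -> \bar R) :
  (forall A B, measurable A -> measurable B ->
    P (Y @^-1` A `&` X @^-1` B) = (P (Y @^-1` A) * P (X @^-1` B))%E) ->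
  same_law X X' -> measurable_fun setT h -> (forall z, (0 <= h z)%E) ->
  (\int[P]_w h (Y w, X w) = \int[P]_w \int[P]_w' h (Y w, X' w'))%E.
Proof.
move=> ind law mh h0.
have mpair : measurable_fun setT (fun w => (Y w, X w)) by apply: measurable_fun_pair.
pose f : {mfun Omega >-> (S * T)%type} := mfun_Sub (mem_set mpair).
have prodE : forall C : set (S * T), measurable C ->
    (distribution P Y \x distribution P X')%E C = distribution P f C.
  apply: product_measure_unique => A B mA mB.
  transitivity (P (Y @^-1` A) * P (X @^-1` B))%E; first exact: ind.
  by congr (_ * _)%E; exact: law.
transitivity (\int[distribution P f]_z h z)%E.
  by rewrite ge0_integral_distribution.
transitivity (\int[(distribution P Y \x distribution P X')%E]_z h z)%E.
  by apply: eq_measure_integral => C mC _; exact/esym/prodE.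
rewrite fubini_tonelli1//.
rewrite ge0_integral_distribution//; last 2 first.
- exact: measurable_fun_fubini_tonelli_F.
- by move=> y; exact: integral_ge0.
apply: eq_integral => w _ /=; rewrite /fubini_F.
rewrite ge0_integral_distribution//.
exact: measurableT_comp.
Qed.

Lemma measurable_ge0_integral_section d1 d2 (S : measurableType d1)
    (T : measurableType d2) (Y : {RV P >-> S}) (X : {RV P >-> T}) (h : S * T -> \bar R) :
  measurable_fun setT h -> (forall z, (0 <= h z)%E) ->
  measurable_fun setT (fun w => \int[P]_w' h (Y w, X w'))%E.
Proof.
move=> mh h0.
rewrite (_ : (fun w => _) = fubini_F (distribution P X) h \o Y).
  apply: measurableT_comp; last exact: measurable_funPT.
  exact: measurable_fun_fubini_tonelli_F.
apply/funext => w; rewrite /= /fubini_F ge0_integral_distribution//.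
exact: measurableT_comp.
Qed.

End independence.

(** * Decay of the moments *)

Section one_step.
Context (R : realType) (H : completeNormedModType R) (dot : {dot H for idfun}).
Context d (Omega : measurableType d) (P : probability Omega R).
Variables (X : {RV P >-> borel H}) (m : H).
Hypothesis dot_norm : induces_norm dot.
Hypothesis Hsep : separable H.
Hypothesis A1 : assumption_A1 dot X.
Hypothesis m_median : geometric_median X m.

(** Averages [lyap_step] over the sample, inserts [integral_drift], and concludes by
    [lyap_contraction]; the constants do not depend on [z]. *)
Lemma expected_lyap_step (p : R) : 1 <= p ->
  exists g0 c C : R, [/\ 0 < g0, 0 < c, 0 < C & forall (g : R) (z : H),
    0 < g -> g <= g0 ->
    (\int[P]_w (lyap p g (`|sgd_step g z (X w) - m| ^+ 2))%:E <=
      ((1 - c * g) * lyap p g (`|z - m| ^+ 2) + C * (g * g `^ p))%:E)%E].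
Proof.
move=> p1; have [c c0 hc] := integral_drift dot_norm Hsep A1 m_median.
have [g0 [C [g00 C0 hC]]] := lyap_contraction p1 c0.
exists g0, (c / 2), C; split => //; first by rewrite divr_gt0.
move=> g z gp gg0.
pose V := `|z - m| ^+ 2; rewrite -/V.
have V0 : 0 <= V by exact: sqr_ge0.
have [g1 gs {}hC] := hC g V gp gg0 V0.
pose s w := drift dot m z (X w).
have is_ : P.-integrable setT (EFin \o s) by exact: (integrable_drift X m dot_norm Hsep z).
set a := 1 + _ in hC; set b := lyap_slope p g V in hC.
(* This sign allows the upper bound on the mean drift to be inserted. *)
have b0 : 0 <= 2 * g * b.
  by rewrite mulr_ge0 ?mulr_ge0 ?(ltW gp)//; apply: lyap_slope_ge0 => //; lra.
have L0 : 0 <= lyap p g V by exact: expR_ge0.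
pose A := lyap p g V * a; pose B := lyap p g V * (2 * g * b).
have B0 : 0 <= B by exact: mulr_ge0.
have hle w : lyap p g (`|sgd_step g z (X w) - m| ^+ 2) <= A + B * s w.
  have sV : s w ^+ 2 <= V.
    rewrite -(@real_normK _ (s w)) ?num_real// /V ler_pXn2r ?nnegrE//.
    exact: drift_le.
  have nU : g ^+ 2 * (`|(X w : H) - z|^-1 * `|(X w : H) - z|) ^+ 2 <= g ^+ 2.
    rewrite ler_piMr ?sqr_ge0// expr_le1 ?mulr_ge0 ?invr_ge0//.
    have [->|n0] := eqVneq `|(X w : H) - z| 0; first by rewrite mulr0.
    by rewrite mulVf.
  rewrite /A /B -mulrA -mulrDr.
  apply: lyap_step => //; rewrite ?sqr_ge0//; first lra.
  by rewrite (sgd_step_normB_sqr dot_norm) -/V addrA lerD2l.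
have iA : P.-integrable setT (EFin \o (fun _ : Omega => A)).
  by apply: (@bounded_integrable _ _ _ _ _ `|A|).
have iB : P.-integrable setT (fun w => (B%:E * (s w)%:E)%E).
  exact: integrableZl.
apply: (@le_trans _ _ (\int[P]_w (A%:E + B%:E * (s w)%:E))%E).
  apply: ge0_le_integral => //.
  - by move=> w _; rewrite lee_fin expR_ge0.
  - apply/measurable_EFinP; apply: measurable_lyap.
    apply: measurable_funX.
    apply: (measurableT_comp (measurable_normB_cst m)).
    by apply: (measurable_sgd_step Hsep dot_norm) => //; exact: measurable_funPT.
  - exact: (measurable_int P (integrableD measurableT iA iB)).
  - by move=> w _; rewrite -EFinM -EFinD lee_fin.
rewrite (integralD measurableT iA iB) integral_cst// integralZl//.
rewrite -[X in (_ * X + _)%E]/(P setT) probability_setT mule1.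
apply: (@le_trans _ _ (A%:E + B%:E * (- (c * (V / Num.sqrt (1 + V))))%:E)%E).
  by apply: leeD2l; apply: lee_wpmul2l; [rewrite lee_fin|exact: hc].
rewrite -EFinM -EFinD lee_fin; apply: le_trans hC.
rewrite /A /B le_eqVlt; apply/orP; left; apply/eqP; ring.
Qed.

End one_step.

(** * Step sizes and numerical recursions *)

Lemma powR_nat_unbounded (R : realType) (a M : R) : 0 < a ->
  exists N : nat, forall n, (N <= n)%N -> M <= n%:R `^ a.
Proof.
move=> a0; exists (Num.truncn (`|M| `^ a^-1)).+1 => n nN.
have h : `|M| `^ a^-1 <= n%:R.
  by rewrite (le_trans (ltW (truncnS_gt _)))// ler_nat.
apply: (le_trans (ler_norm M)).
have -> : `|M| = (`|M| `^ a^-1) `^ a.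
  by rewrite -powRrM mulVf ?powRr1// gt_eqF.
by apply: ge0_ler_powR; rewrite ?nnegrE ?powR_ge0// ltW.
Qed.

Lemma step_size_gt0 (R : realType) (c alpha : R) n : 0 < c -> (0 < n)%N ->
  0 < step_size c alpha n.
Proof. by move=> c0 n0; rewrite mulr_gt0// powR_gt0// ltr0n. Qed.

Lemma step_size_nonincreasing (R : realType) (c alpha : R) n : 0 < c -> 0 <= alpha ->
  (0 < n)%N -> step_size c alpha n.+1 <= step_size c alpha n.
Proof.
move=> c0 a0 n0; rewrite /step_size ler_pM2l// !powRN lef_pV2 ?posrE ?powR_gt0 ?ltr0n//.
by apply: ge0_ler_powR; rewrite ?nnegrE ?ler0n// ler_nat.
Qed.

(** In logarithms, [ln n.+1%:R - ln n%:R <= n%:R^-1]; then [expR (- x) >= 1 - x] and [alpha <= 1]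
    conclude. *)
Lemma step_size_powR_succ (R : realType) (c alpha p : R) n : 0 < c -> 0 <= alpha <= 1 ->
  0 <= p -> (0 < n)%N ->
  step_size c alpha n `^ p * (1 - p / n%:R) <= step_size c alpha n.+1 `^ p.
Proof.
move=> c0 /andP[a0 a1] p0 n0.
have n0R : 0 < n%:R :> R by rewrite ltr0n.
have n1R : 0 < n.+1%:R :> R by rewrite ltr0n.
have lnE k : (0 < k)%N -> ln (step_size c alpha k) = ln c - alpha * ln (k%:R : R).
  move=> k0; rewrite /step_size lnM ?posrE ?powR_gt0 ?ltr0n//.
  by rewrite ln_powR mulNr.
rewrite /powR !gt_eqF ?step_size_gt0// !lnE//.
have h : ln n.+1%:R <= ln n%:R + n%:R^-1 :> R.
  apply: (le_trans (ln_tangent n0R n1R)).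
  by rewrite -natr1 addrAC subrr add0r mulr1.
apply: (@le_trans _ _ (expR (p * (ln c - alpha * ln n%:R)) * expR (- (p * (alpha / n%:R))))).
  rewrite ler_wpM2l ?expR_ge0//; apply: le_trans (expR_ge1Dx _).
  rewrite lerD2l lerN2 ler_wpM2l//.
  by rewrite -[leRHS]mul1r ler_wpM2r// invr_ge0 ltW.
rewrite -expRD ler_expR -mulrBr ler_wpM2l//.
have := ler_wpM2l a0 h; lra.
Qed.

(** The step size tends to 0, but [n] times the step size tends to infinity since [alpha < 1]. Hence
    the relative decrease [p / n] of its power is eventually below half the contraction rate. *)
Lemma step_size_eventually (R : realType) (c alpha p g0 k : R) : 0 < c ->
  0 < alpha < 1 -> 0 < g0 -> 0 < k ->
  exists N : nat, (0 < N)%N /\ forall n, (N <= n)%N ->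
    [/\ step_size c alpha n <= g0, k * step_size c alpha n <= 1 &
        p / n%:R <= k / 2 * step_size c alpha n].
Proof.
move=> c0 /andP[a0 a1] g00 k0.
have [N1 h1] := powR_nat_unbounded (c / g0) a0.
have [N2 h2] := powR_nat_unbounded (c * k) a0.
have a1' : 0 < 1 - alpha by lra.
have [N3 h3] := powR_nat_unbounded (2 * p / (k * c)) a1'.
exists (maxn 1 (maxn N1 (maxn N2 N3))); split; first by rewrite leq_max.
move=> n; rewrite !geq_max => /and4P[n0 n1 n2 n3].
have n0R : 0 < n%:R :> R by rewrite ltr0n.
have na : 0 < n%:R `^ alpha :> R by rewrite powR_gt0.
have {}h1 := h1 n n1; have {}h2 := h2 n n2; have {}h3 := h3 n n3.
have nE : n%:R `^ (1 - alpha) = n%:R * n%:R `^ (- alpha) :> R.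
  by rewrite powRD ?powRr1 ?ltW// gt_eqF// implybT.
split.
- by rewrite /step_size powRN ler_pdivrMr// mulrC -ler_pdivrMr.
- by rewrite /step_size powRN mulrA ler_pdivrMr// mul1r mulrC.
- rewrite ler_pdivrMr// /step_size.
  move: h3; rewrite nE ler_pdivrMr ?mulr_gt0//; lra.
Qed.

(** Half of the contraction [c * g n] pays for the decrease of [r]; the other half absorbs the
    source term because the constant is at least [2 * C / c]. *)
Lemma decay_recursion (R : realType) (u : nat -> \bar R) (g r : nat -> R)
    (c C K1 : R) (N : nat) : 0 < c -> 0 <= C -> (forall n, 0 <= r n) ->
  (u N <= (K1 * r N)%:E)%E ->
  (forall n, (N <= n)%N ->
    [/\ 0 <= g n, c * g n <= 1, r n * (1 - c / 2 * g n) <= r n.+1 &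
     (u n.+1 <= (1 - c * g n)%:E * u n + (C * (g n * r n))%:E)%E]) ->
  forall n, (N <= n)%N -> (u n <= (Num.max K1 (2 * C / c) * r n)%:E)%E.
Proof.
move=> c0 C0 r0 uN hu; set K := Num.max _ _; elim=> [|n IH].
  rewrite leqn0 => /eqP N0; move: uN; rewrite N0 => uN.
  by apply: (le_trans uN); rewrite lee_fin ler_wpM2r// le_max lexx.
rewrite leq_eqVlt => /orP[/eqP <-|nN].
  by apply: (le_trans uN); rewrite lee_fin ler_wpM2r// le_max lexx.
have [g0 cg1 hr hun] := hu n nN.
apply: (le_trans hun).
apply: (@le_trans _ _
  ((1 - c * g n)%:E * (K * r n)%:E + (C * (g n * r n))%:E)%E).
  by apply: leeD2r; apply: lee_wpmul2l; [rewrite lee_fin; lra|exact: IH].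
rewrite -EFinM -EFinD lee_fin.
have K2 : 2 * C / c <= K by rewrite /K le_max lexx orbT.
have K0 : 0 <= K by apply: le_trans K2; rewrite divr_ge0 ?mulr_ge0// ltW.
have CK : C <= K * (c / 2) by move: K2; rewrite ler_pdivrMr//; lra.
apply: (@le_trans _ _ (K * (r n * (1 - c / 2 * g n)))); last by rewrite ler_wpM2l.
have := ler_wpM2r (mulr_ge0 g0 (r0 n)) CK; lra.
Qed.

(** Lowers the threshold [N] one index at a time, enlarging the constant by the finite value at that
    index. *)
Lemma patch_finitely_many (R : realType) (u : nat -> \bar R) (r : nat -> R)
    (K0 : R) (N : nat) : (forall n, (0 < n)%N -> 0 < r n) ->
  (forall n, (0 < n)%N -> exists k : R, (u n <= k%:E)%E) ->
  (forall n, (N <= n)%N -> (0 < n)%N -> (u n <= (K0 * r n)%:E)%E) ->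
  exists K : R, 0 < K /\ forall n, (0 < n)%N -> (u n <= (K * r n)%:E)%E.
Proof.
move=> r0; elim: N K0 => [|N IH] K0 hu hN.
  exists (`|K0| + 1); split; first by rewrite ltr_wpDl.
  move=> n n0; apply: (le_trans (hN n (leq0n n) n0)).
  by rewrite lee_fin ler_pM2r ?r0// (le_trans (ler_norm _))// lerDl.
have [N0|N0] := posnP N.
  by apply: (IH K0) => // n _ n0; apply: hN => //; rewrite N0.
have [k hk] := hu N N0.
apply: (IH (Num.max K0 (k / r N))) => // n nN n0.
move: nN; rewrite leq_eqVlt => /orP[/eqP <-|nN].
  apply: (le_trans hk); rewrite lee_fin -ler_pdivrMr ?r0//.
  by rewrite le_max lexx orbT.
apply: (le_trans (hN n nN n0)); rewrite lee_fin ler_pM2r ?r0//.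
by rewrite le_max lexx.
Qed.

(** * Moments of the stochastic gradient sequence *)

Section sgd_moments.
Context (R : realType) (H : completeNormedModType R) (dot : {dot H for idfun}).
Context d (Omega : measurableType d) (P : probability Omega R).
Variables (X : {RV P >-> borel H}) (m : H) (alpha c_gamma : R).
Hypothesis dot_norm : induces_norm dot.
Hypothesis Hsep : separable H.
Hypothesis A1 : assumption_A1 dot X.
Hypothesis m_median : geometric_median X m.
Hypothesis alpha01 : 0 < alpha < 1.
Hypothesis c0 : 0 < c_gamma.
Variables (Xs : nat -> {RV P >-> borel H}) (Z : nat -> Omega -> H).
Hypothesis Xs_indep : mutually_independent (fun n => Xs n.+1).
Hypothesis Xs_law : forall n : nat, (0 < n)%N -> same_law (Xs n) X.
Hypothesis Z1_measurable : sigma_measurable (Xs 1%N) (Z 1%N : Omega -> borel H).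
Hypothesis Z1_bounded : exists M : R, {ae P, forall w, `|Z 1%N w| <= M}.
Hypothesis Z_sgd : sgd_sequence (step_size c_gamma alpha) Xs Z.

Let g := step_size c_gamma alpha.

Lemma sgd_sequence_step n w : (0 < n)%N ->
  Z n.+1 w = sgd_step (g n) (Z n w) (Xs n.+1 w).
Proof. by move=> n0; rewrite Z_sgd. Qed.

Lemma measurable_sgd n : (0 < n)%N -> measurable_fun setT (Z n : Omega -> borel H).
Proof.
case: n => // n _; elim: n => [|n IH].
  move=> _ A mA; have [B mB <-] := Z1_measurable measurableT mA.
  by rewrite setTI; exact: measurable_funPTI.
rewrite (_ : Z n.+2 = fun w => sgd_step (g n.+1) (Z n.+1 w) (Xs n.+2 w)); last first.
  by apply/funext => w; rewrite sgd_sequence_step.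
by apply: (measurable_sgd_step Hsep dot_norm) => //; exact: measurable_funPT.
Qed.

(** Each step has length at most [g n]. The bound may grow with [n]; it serves only to make each
    expectation finite. *)
Lemma sgd_ae_bounded n : (0 < n)%N -> exists M : R, {ae P, forall w, `|Z n w - m| <= M}.
Proof.
case: n => // n _; elim: n => [|n [M hM]].
  have [M hM] := Z1_bounded; exists (M + `|m|).
  by apply: filterS hM => w h; rewrite (le_trans (ler_normB _ _))// lerD2r.
exists (M + g n.+1); apply: filterS hM => w h.
rewrite sgd_sequence_step// /sgd_step addrAC (le_trans (ler_normD _ _))// lerD//.
have g0 : 0 < g n.+1 by exact: step_size_gt0.
rewrite normrZ (gtr0_norm g0) ler_piMr ?(ltW g0)//.
rewrite normrZ normfV normr_id; have [->|n0] := eqVneq `|(Xs n.+2 w : H) - Z n.+1 w| 0.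
  by rewrite mulr0.
by rewrite mulVf.
Qed.

Lemma measurable_normB_sgd n : (0 < n)%N -> measurable_fun setT (fun w => `|Z n w - m|).
Proof.
by move=> n0; apply: (measurableT_comp (measurable_normB_cst m)); exact: measurable_sgd.
Qed.

Lemma measurable_lyap_sgd p n k : (0 < n)%N ->
  measurable_fun setT (fun w => (lyap p (g k) (`|Z n w - m| ^+ 2))%:E).
Proof.
move=> n0; apply/measurable_EFinP; apply: measurable_lyap; apply: measurable_funX.
exact: measurable_normB_sgd.
Qed.

Lemma expected_lyap_finite p n : 0 <= p -> (0 < n)%N -> exists k : R,
  (\int[P]_w (lyap p (g n) (`|Z n w - m| ^+ 2))%:E <= k%:E)%E.
Proof.
move=> p0 n0; have [M hM] := sgd_ae_bounded n0.
have g0 : 0 < g n by exact: step_size_gt0.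
exists (lyap p (g n) (M ^+ 2)).
have -> : (lyap p (g n) (M ^+ 2))%:E = (\int[P]_w (cst (lyap p (g n) (M ^+ 2))%:E) w)%E.
  by rewrite integral_cst// -[X in (_ * X)%E]/(P setT) probability_setT mule1.
apply: ae_ge0_le_integral; first exact: measurableT.
- by move=> w _; rewrite lee_fin expR_ge0.
- exact: measurable_lyap_sgd.
- by move=> w _; rewrite lee_fin expR_ge0.
- exact: measurable_cst.
apply: filterS hM => w h _; rewrite lee_fin lyap_homo ?sqr_ge0//.
by rewrite ler_pXn2r ?nnegrE// (le_trans _ h).
Qed.

(** Indices are shifted by one, so that the recursion starts at 0 as in [recursion_indep_future]. *)
Definition sgd_rv n : {RV P >-> borel H} :=
  mfun_Sub (mem_set (measurable_sgd (ltn0Sn n))).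

(** [Z n] depends on the first [n] samples only, hence is independent of [Xs n.+1], which has the
    law of [X]. *)
Lemma expected_lyap_sgd_step n p : (0 < n)%N ->
  (\int[P]_w (lyap p (g n) (`|Z n.+1 w - m| ^+ 2))%:E =
   \int[P]_w \int[P]_w'
     (lyap p (g n) (`|sgd_step (g n) (Z n w) (X w') - m| ^+ 2))%:E)%E.
Proof.
case: n => // n _.
pose F k (z : borel H * borel H) : borel H := sgd_step (g k.+1) z.1 z.2.
have mF k : measurable_fun setT (F k).
  apply: (measurable_sgd_step Hsep dot_norm); [exact: measurable_snd|exact: measurable_fst].
have ind A B : measurable A -> measurable B ->
    P (sgd_rv n @^-1` A `&` Xs n.+2 @^-1` B) = (P (sgd_rv n @^-1` A) * P (Xs n.+2 @^-1` B))%E.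
  move=> mA mB.
  have := @recursion_indep_future _ _ _ P _ _ _ _ (fun k => Xs k.+1) sgd_rv F Xs_indep
    Z1_measurable mF (fun k w => sgd_sequence_step w (ltn0Sn k)) n [fset n.+1]%fset A
    (fun=> B) mA (fun _ _ => mB).
  rewrite set_fset1 bigcap_set1; apply.
  by move=> j; rewrite inE => /eqP ->.
pose h (z : borel H * borel H) := (lyap p (g n.+1) (`|(F n z : H) - m| ^+ 2))%:E.
rewrite -(@ge0_integral_indep _ _ _ P _ _ _ _ (sgd_rv n) (Xs n.+2) X h ind (Xs_law (ltn0Sn _))).
- by apply: eq_integral => w _; rewrite sgd_sequence_step.
- apply/measurable_EFinP; apply: measurable_lyap; apply: measurable_funX.
  exact: (measurableT_comp (measurable_normB_cst m) (mF n)).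
- by move=> z; rewrite lee_fin expR_ge0.
Qed.

Lemma sgd_moment_bound (p : R) : 1 <= p -> exists K : R, 0 < K /\
  forall n, (0 < n)%N -> ('E_P[fun w => (`|Z n w - m| `^ (2 * p))%R]
     <= (K / n%:R `^ (p * alpha))%R%:E)%E.
Proof.
move=> p1; have p0 : 0 <= p by lra.
have [g0 [c [C [g00 cp C0 hstep]]]] := expected_lyap_step dot_norm Hsep A1 m_median p1.
have [N [N0 hN]] := step_size_eventually p c0 alpha01 g00 cp.
have /andP[a0 a1] := alpha01.
pose u n := (\int[P]_w (lyap p (g n) (`|Z n w - m| ^+ 2))%:E)%E.
have gp n : (0 < n)%N -> 0 < g n by exact: step_size_gt0.
have [k hk] := expected_lyap_finite p0 N0.
have uN : (u N <= ((k / g N `^ p) * g N `^ p)%:E)%E.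
  by rewrite divfK// gt_eqF// powR_gt0 ?gp.
have rec n : (N <= n)%N ->
    [/\ 0 <= g n, c * g n <= 1, g n `^ p * (1 - c / 2 * g n) <= g n.+1 `^ p &
     (u n.+1 <= (1 - c * g n)%:E * u n + (C * (g n * g n `^ p))%:E)%E].
  move=> Nn; have n0 := leq_trans N0 Nn; have [h1 h2 h3] := hN n Nn.
  split => //; first exact: ltW (gp n n0).
    apply: le_trans (step_size_powR_succ c0 _ p0 n0); last by rewrite !ltW.
    by rewrite ler_wpM2l ?powR_ge0// lerD2l lerN2.
  (* Replacing [g n.+1] by the larger [g n] only increases [lyap]. *)
  apply: (@le_trans _ _ (\int[P]_w (lyap p (g n) (`|Z n.+1 w - m| ^+ 2))%:E)%E).
    apply: ge0_le_integral; first exact: measurableT.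
    - by move=> w _; rewrite lee_fin expR_ge0.
    - exact: measurable_lyap_sgd.
    - exact: measurable_lyap_sgd.
    - move=> w _; rewrite lee_fin lyap_homo ?sqr_ge0 ?gp//.
      by apply: step_size_nonincreasing => //; exact: ltW.
  rewrite expected_lyap_sgd_step//.
  have c1 : 0 <= 1 - c * g n by rewrite subr_ge0.
  have C1 : 0 <= C * (g n * g n `^ p) by rewrite !mulr_ge0 ?powR_ge0// ltW// gp.
  have mu := measurable_lyap_sgd p n n0.
  apply: (@le_trans _ _ (\int[P]_w ((1 - c * g n)%:E *
      (lyap p (g n) (`|Z n w - m| ^+ 2))%:E + (C * (g n * g n `^ p))%:E))%E).
    apply: ge0_le_integral; first exact: measurableT.
    - by move=> w _; apply: integral_ge0 => w' _; rewrite lee_fin expR_ge0.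
    - case: n n0 {Nn h1 h2 h3 c1 C1 mu} => // n _.
      apply: (@measurable_ge0_integral_section _ _ _ P _ _ _ _ (sgd_rv n) X
        (fun z => (lyap p (g n.+1) (`|sgd_step (g n.+1) z.1 z.2 - m| ^+ 2))%:E)).
        apply/measurable_EFinP; apply: measurable_lyap; apply: measurable_funX.
        apply: (measurableT_comp (measurable_normB_cst m)).
        apply: (measurable_sgd_step Hsep dot_norm); [exact: measurable_snd|exact: measurable_fst].
      by move=> z; rewrite lee_fin expR_ge0.
    - by apply: emeasurable_funD => //; exact: measurable_funeM.
    - by move=> w _; rewrite -EFinM -EFinD; apply: hstep; rewrite ?gp.
  rewrite ge0_integralD//; last 2 first.
    by move=> w _; rewrite -EFinM lee_fin mulr_ge0 ?expR_ge0.
    exact: measurable_funeM.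
  rewrite ge0_integralZl_EFin//; last by move=> w _; rewrite lee_fin expR_ge0.
  by rewrite integral_cst// -[X in (_ + _ * X)%E]/(P setT) probability_setT mule1.
have decay := decay_recursion cp (ltW C0) (fun n => powR_ge0 (g n) p) uN rec.
set K0 := Num.max _ _ in decay.
have mom n : (0 < n)%N ->
    ('E_P[fun w => (`|Z n w - m| `^ (2 * p))%R] <= u n)%E.
  move=> n0; rewrite unlock; apply: ge0_le_integral; first exact: measurableT.
  - by move=> w _; rewrite lee_fin powR_ge0.
  - apply/measurable_EFinP; apply: (measurableT_comp (measurable_powR _)).
    exact: measurable_normB_sgd.
  - exact: measurable_lyap_sgd.
  - by move=> w _; rewrite lee_fin powR_le_lyap ?gp//; lra.
pose r n : R := (n%:R `^ (p * alpha))^-1.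
have grE n : (0 < n)%N -> g n `^ p = c_gamma `^ p * r n.
  move=> n0; rewrite /g /step_size powRM ?powR_ge0 ?(ltW c0)//.
  by rewrite -powRrM /r -powRN mulNr (mulrC alpha).
apply: (@patch_finitely_many _ _ r (K0 * c_gamma `^ p) N).
- by move=> n n0; rewrite invr_gt0 powR_gt0 ?ltr0n.
- move=> n n0; have [k' hk'] := expected_lyap_finite p0 n0.
  by exists k'; exact: le_trans (mom n n0) hk'.
- move=> n Nn n0; apply: (le_trans (mom n n0)); apply: (le_trans (decay n Nn)).
  by rewrite grE// mulrA.
Qed.

End sgd_moments.

Theorem theorem4p1 (R : realType) (H : completeNormedModType R)
    (dot : {dot H for idfun})
    (dot_norm : induces_norm dot) (H_separable : separable H)
    (d : measure_display) (Omega : measurableType d) (P : probability Omega R)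
    (X : {RV P >-> borel H})
    (A1 : assumption_A1 dot X) (A2 : assumption_A2 X)
    (m : H) (m_median : geometric_median X m)
    (alpha c_gamma : R) (alpha_bounds : 1 / 2 < alpha < 1)
    (c_gamma_gt0 : 0 < c_gamma)
    (* X_n is [Xs n] for n >= 1; [Xs 0] and [Z 0] are irrelevant. *)
    (Xs : nat -> {RV P >-> borel H})
    (Xs_indep : mutually_independent (fun n => Xs n.+1))
    (Xs_law : forall n : nat, (0 < n)%N -> same_law (Xs n) X)
    (Z : nat -> Omega -> H)
    (Z1_measurable : sigma_measurable (Xs 1%N) (Z 1%N : Omega -> borel H))
    (Z1_bounded : exists M : R, {ae P, forall w, `|Z 1%N w| <= M})
    (Z_sgd : sgd_sequence (step_size c_gamma alpha) Xs Z) :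
  forall p : R, 1 <= p ->
    exists K : R, [/\ 0 < K,
      forall n : nat, (0 < n)%N ->
        ('E_P[fun w => (`|Z n w - m| `^ (2 * p))%R]
          <= (K / n%:R `^ (p * alpha))%R%:E)%E &
      forall n : nat, (0 < n)%N ->
        ('E_P[fun w => (`|Z n w - m| `^ p)%R]
          <= (Num.sqrt K / n%:R `^ (p * alpha / 2))%R%:E)%E].
Proof.
move=> p p1.
have alpha01 : 0 < alpha < 1 by move/andP: alpha_bounds => [? ?]; apply/andP; split; lra.
have [K [K0 hK]] := sgd_moment_bound dot_norm H_separable A1 m_median alpha01
  c_gamma_gt0 Xs_indep Xs_law Z1_measurable Z1_bounded Z_sgd p1.
exists K; split => // n n0.
have n0R : 0 < n%:R :> R by rewrite ltr0n.
(* The target bound. Its square bounds the moment of order [2 * p], so the averaged inequality ends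
   with [a / 2 + a ^+ 2 / (2 * a) = a]. *)
pose a := Num.sqrt K / n%:R `^ (p * alpha / 2).
have a0 : 0 < a by rewrite divr_gt0 ?sqrtr_gt0 ?powR_gt0.
have aa : K / n%:R `^ (p * alpha) = a ^+ 2.
  rewrite /a exprMn sqr_sqrtr ?(ltW K0)// exprVn -powR_mulrn ?powR_ge0//.
  by rewrite -powRrM divfK.
have mZ := measurable_normB_sgd m dot_norm H_separable Z1_measurable Z_sgd n0.
have mp q : measurable_fun setT (fun w => (`|Z n w - m| `^ q)%:E).
  by apply/measurable_EFinP; exact: (measurableT_comp (measurable_powR q) mZ).
(* AM-GM: [y <= a / 2 + y ^+ 2 / (2 a)]. *)
apply: (@le_trans _ _ (\int[P]_w ((a / 2)%:E + ((2 * a)^-1)%:E * (`|Z n w - m| `^ (2 * p))%:E))%E).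
  rewrite unlock; apply: ge0_le_integral; first exact: measurableT.
  - by move=> w _; rewrite lee_fin powR_ge0.
  - exact: mp.
  - by apply: emeasurable_funD => //; exact: measurable_funeM.
  - move=> w _; rewrite -EFinM -EFinD lee_fin (mulrC 2 p) powRrM powR_mulrn ?powR_ge0//.
    move: (_ `^ p) => y.
    have -> : a / 2 + (2 * a)^-1 * y ^+ 2 = y + (2 * a)^-1 * (y - a) ^+ 2.
      by field; rewrite gt_eqF.
    by rewrite lerDl mulr_ge0 ?sqr_ge0// invr_ge0 mulr_ge0// ltW.
rewrite ge0_integralD//; last 3 first.
- by move=> w _; rewrite lee_fin divr_ge0// ltW.
- by move=> w _; rewrite -EFinM lee_fin mulr_ge0 ?powR_ge0// invr_ge0 mulr_ge0// ltW.
- exact: measurable_funeM.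
rewrite integral_cst// -[X in (_ * X + _)%E]/(P setT) probability_setT mule1.
have ia : 0 <= (2 * a)^-1 by rewrite invr_ge0 mulr_ge0// ltW.
rewrite ge0_integralZl_EFin//.
have := hK n n0; rewrite unlock aa => h.
apply: (@le_trans _ _ ((a / 2)%:E + ((2 * a)^-1)%:E * (a ^+ 2)%:E)%E).
  by apply: leeD2l; apply: lee_wpmul2l; rewrite ?lee_fin.
rewrite -EFinM -EFinD lee_fin -/a le_eqVlt; apply/orP; left; apply/eqP.
by field; rewrite gt_eqF.
Qed.
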